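(* Let $r(\theta)=\mathbb E_{\theta'\sim q(\cdot|\theta)}[r(\theta,\theta')]$. If the pseudo-marginal kernel $\mathsf{P}_{\mathrm{pm}}$ has a left spectral gap of $\epsilon^{\mathrm L}_{\mathrm{pm}}$, then for all $h\in L^2(\pi\times\nu)$, $$\mathsf{Var}_{\mathsf{P}_{\mathrm{pm}}}(h)\ge\left\{-\frac{1}{\epsilon^{\mathrm L}_{\mathrm{pm}}}+\frac{\epsilon^{\mathrm L}_{\mathrm{pm}}}{4-2\epsilon^{\mathrm L}_{\mathrm{pm}}}\right\}\|h\|^2_{L^2(\pi\times\nu)}+\frac12\int\pi(\theta)\,\widetilde q_\theta(w)\,h(\theta,w)^2\,\frac{w^2}{r(\theta)}\,\mathrm dw\,\mathrm d\theta .$$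
   Context: Let $\pi$ be a probability density (with respect to Lebesgue measure) on $\mathcal X\subseteq\mathbb R^d$ and, for each $\theta\in\mathcal X$, let $q(\cdot|\theta)$ be a proposal density on $\mathcal X$. Put $r(\theta,\theta')=\frac{\pi(\theta')q(\theta|\theta')}{\pi(\theta)q(\theta'|\theta)}$ and $r(\theta)=\mathbb E_{\theta'\sim q(\cdot|\theta)}[r(\theta,\theta')]=\frac1{\pi(\theta)}\int\pi(\theta')q(\theta|\theta')\,\mathrm d\theta'$. Let $\mathcal W\subseteq[0,\infty)$ and, for each $\theta$, let $\widetilde q_\theta$ be a probability density on $\mathcal W$ (which may depend on $\theta$) with $\int_{\mathcal W}w\,\widetilde q_\theta(w)\,\mathrm dw=1$; set $\nu_\theta(w)=w\,\widetilde q_\theta(w)$. The pseudo-marginal kernel $\mathsf{P}_{\mathrm{pm}}$ on $\mathcal X\times\mathcal W$, from $(\theta,w)$, proposes $(\theta',w')$ from the density $q(\theta'|\theta)\widetilde q_{\theta'}(w')$ and accepts with probability $1\wedge\{r(\theta,\theta')w'/w\}$ (otherwise it stays at $(\theta,w)$); it is reversible with respect to the probability density $\pi(\theta)\nu_\theta(w)$, and $L^2(\pi\times\nu)$ denotes the $L^2$ space of this probability distribution. For a Markov kernel $Q$ with stationary distribution $\mu$ and $h\in L^2(\mu)$, the asymptotic variance is $\mathsf{Var}_Q(h)=\lim_{n\to\infty}n\,\mathsf{Var}\left[\frac1n\sum_{i=1}^n h(X_i)\right]\in[0,\infty]$, where $(X_i)$ is the Markov chain with kernel $Q$ and $X_1\sim\mu$.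 With $L_0^2(\mu)=\{f\in L^2(\mu):\int f\,\mathrm d\mu=0\}$, the left spectral gap of $Q$ is $\epsilon_Q^{\mathrm L}=1+\inf\left\{\iint\mu(\mathrm dx)Q(x,\mathrm dy)f(x)f(y):f\in L_0^2(\mu),\ \|f\|_{L^2(\mu)}=1\right\}$; ''has a left spectral gap'' means that this quantity is strictly positive, and $\epsilon^{\mathrm L}_{\mathrm{pm}}>0$ denotes its value for $Q=\mathsf{P}_{\mathrm{pm}}$.
   Formalization: h is assumed to have mean zero under π×ν (h in L_0^2) instead of being any h in L^2(π×ν); for general h the inequality fails, e.g. a constant h=1 has zero asymptotic variance while the right-hand side can be positive. *)

(* Defs.v *)
From HB Require Import structures.
From mathcomp Require Import all_boot all_order all_algebra.
From mathcomp Require Import all_classical all_reals all_analysis.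
From mathcomp Require Import measurable_realfun.

Set Implicit Arguments.
Unset Strict Implicit.
Unset Printing Implicit Defensive.

Import Order.TTheory GRing.Theory Num.Theory.
Import numFieldNormedType.Exports.

Local Open Scope classical_set_scope.
Local Open Scope ring_scope.

(* For [product_measure1] itself, canonical inference only finds a sigma-finite
   structure when both factors are subprobabilities, hence this alias. *)
Section sigma_finite_product.
Context d1 d2 (T1 : measurableType d1) (T2 : measurableType d2) (R : realType).
Variable m1 : {sigma_finite_measure set T1 -> \bar R}.
Variable m2 : {sigma_finite_measure set T2 -> \bar R}.

Definition sf_product : set (T1 * T2) -> \bar R := product_measure1 m1 m2.

Let sf_product0 : sf_product set0 = 0%E.
Proof. exact: (@measure0 _ _ _ (product_measure1 m1 m2)). Qed.

Let sf_product_ge0 A : (0 <= sf_product A)%E.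
Proof. exact: (@measure_ge0 _ _ _ (product_measure1 m1 m2)). Qed.

Let sf_product_sigma_additive : semi_sigma_additive sf_product.
Proof.
exact: (@measure_semi_sigma_additive _ _ _ (product_measure1 m1 m2)).
Qed.

HB.instance Definition _ := isMeasure.Build _ _ _ sf_product
  sf_product0 sf_product_ge0 sf_product_sigma_additive.

Let sf_product_sigma_finite : sigma_finite setT sf_product.
Proof.
have /sigma_finiteP[F [TF ndF Foo]] := sigma_finiteT m1.
have /sigma_finiteP[G [TG ndG Goo]] := sigma_finiteT m2.
exists (fun n => F n `*` G n).
 rewrite -setXTT TF TG predeqE => -[x y]; split.
    move=> [/= [n _ Fnx] [k _ Gky]]; exists (maxn n k) => //; split.
    - by move: x Fnx; exact/subsetPset/ndF/leq_maxl.
    - by move: y Gky; exact/subsetPset/ndG/leq_maxr.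
  by move=> [n _ []/= ? ?]; split; exists n.
move=> k; have [? ?] := Foo k; have [? ?] := Goo k.
split; first exact: measurableX.
by rewrite /sf_product product_measure1E// lte_mul_pinfty// ge0_fin_numE.
Qed.

HB.instance Definition _ := Measure_isSigmaFinite.Build _ _ _ sf_product
  sf_product_sigma_finite.

End sigma_finite_product.

(* R^d with its product (Borel) sigma-algebra. *)
Notation Rd R d := (d.-tuple (measurableTypeR R)).

Section lebesgue_tuple.
Context {R : realType}.

Definition tcons n (p : measurableTypeR R * Rd R n) : Rd R n.+1 :=
  [tuple of p.1 :: p.2].

Lemma measurable_tcons n : measurable_fun setT (@tcons n).
Proof. exact: measurable_cons. Qed.

Definition tuncons n (t : Rd R n.+1) : measurableTypeR R * Rd R n :=
  (thead t, [tuple of behead t]).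

Lemma measurable_tuncons n : measurable_fun setT (@tuncons n).
Proof.
apply: measurable_fun_pair; first exact: measurable_tnth.
exact: measurable_behead.
Qed.

Lemma tconsK n : cancel (@tcons n) (@tuncons n).
Proof. by case=> x t; congr pair; apply: val_inj. Qed.

Section cons_measure.
Variables (n : nat) (mu : {sigma_finite_measure set (Rd R n) -> \bar R}).

Definition cons_measure : set (Rd R n.+1) -> \bar R :=
  pushforward (sf_product (@lebesgue_measure R) mu) (@tcons n).

Let cons_measure0 : cons_measure set0 = 0%E.
Proof. by rewrite /cons_measure /pushforward preimage_set0 measure0. Qed.

Let cons_measure_ge0 A : (0 <= cons_measure A)%E.
Proof. by rewrite /cons_measure /pushforward. Qed.

Let cons_measure_sigma_additive : semi_sigma_additive cons_measure.
Proof.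
move=> F mF tF mUF; rewrite /cons_measure /pushforward preimage_bigcup.
apply: measure_semi_sigma_additive.
- by move=> i; rewrite -[X in measurable X]setTI; exact: measurable_tcons.
- apply/trivIsetP => /= i j _ _ ij; rewrite -preimage_setI.
  by move/trivIsetP : tF => /(_ _ _ _ _ ij) ->//; rewrite preimage_set0.
- by rewrite -preimage_bigcup -[X in measurable X]setTI; exact: measurable_tcons.
Qed.

HB.instance Definition _ := isMeasure.Build _ _ _ cons_measure
  cons_measure0 cons_measure_ge0 cons_measure_sigma_additive.

Let cons_measure_sigma_finite : sigma_finite setT cons_measure.
Proof.
have [F FT Ffin] := sigma_finiteT (sf_product (@lebesgue_measure R) mu).
exists (fun i => @tuncons n @^-1` F i).
  by rewrite -preimage_bigcup -FT preimage_setT.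
move=> i; have [mF Fi] := Ffin i; split.
  by rewrite -[X in measurable X]setTI; exact: measurable_tuncons.
rewrite /cons_measure /pushforward.
suff -> : @tcons n @^-1` (@tuncons n @^-1` F i) = F i by [].
by apply/seteqP; split => x /=; rewrite tconsK.
Qed.

HB.instance Definition _ := @Measure_isSigmaFinite.Build _ _ _
  cons_measure cons_measure_sigma_finite.

End cons_measure.

End lebesgue_tuple.

Fixpoint lebesgue_Rd (R : realType) (d : nat) :
    {sigma_finite_measure set (Rd R d) -> \bar R} :=
  match d with
  | 0 => \d_([tuple] : Rd R 0)
  | d'.+1 => cons_measure (lebesgue_Rd R d')
  end.

Lemma density_sigma_additive d (T : measurableType d) (R : realType)
    (mu : {measure set T -> \bar R}) (f : T -> R) :
  measurable_fun setT f -> (forall x, 0 <= f x) ->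
  semi_sigma_additive (fun A => \int[mu]_(x in A) (f x)%:E)%E.
Proof.
move=> mf f0 /= F mF tF mUF; apply: cvg_toP.
  apply: ereal_nondecreasing_is_cvgn => m n mn.
  apply: lee_sum_nneg_natr => // k _ _; apply: integral_ge0 => /= x Fkx.
  by rewrite lee_fin.
rewrite ge0_integral_bigcup//=.
- by apply/measurable_funTS/measurable_EFinP.
- by move=> x _; rewrite lee_fin.
Qed.

Section measurable_inv.
Context d (T : measurableType d) (R : realType).

Lemma measurable_fun_invr (D : set T) (f : T -> R) :
  measurable_fun D f -> measurable_fun D (fun x => (f x)^-1).
Proof.
move=> mf.
have -> : (fun x => (f x)^-1) = (fun x => f x * ((f x ^+ 2) `^ (- 1))).
  apply/funext => x; rewrite powR_inv1 ?sqr_ge0//.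
  have [->|f0] := eqVneq (f x) 0; first by rewrite mul0r invr0.
  by rewrite expr2 invfM mulrA divff// mul1r.
apply: measurable_funM => //.
exact: (measurableT_comp (measurable_powR (-1)) (measurable_funX 2 mf)).
Qed.

End measurable_inv.

(* [pm_q t t'] is the proposal density q(t' | t) and [pm_qw t w] the weight
   density qtilde_t(w). All functions are total, but only their values on
   [pm_X] and [pm_W] are constrained and used. *)
Record pm_model (R : realType) (d : nat) := PmModel {
  pm_X : set (Rd R d) ;
  pm_W : set (measurableTypeR R) ;
  pm_pi : Rd R d -> R ;
  pm_q : Rd R d -> Rd R d -> R ;
  pm_qw : Rd R d -> measurableTypeR R -> R ;
  pm_mX : measurable pm_X ;
  pm_mW : measurable pm_W ;
  pm_W_ge0 : forall w, pm_W w -> 0 <= (w : R) ;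
  pm_mpi : measurable_fun pm_X pm_pi ;
  pm_pi_ge0 : forall t, pm_X t -> 0 <= pm_pi t ;
  pm_pi1 : (\int[lebesgue_Rd R d]_(t in pm_X) (pm_pi t)%:E = 1)%E ;
  pm_mq : measurable_fun (pm_X `*` pm_X) (fun p => pm_q p.1 p.2) ;
  pm_q_ge0 : forall t t', pm_X t -> pm_X t' -> 0 <= pm_q t t' ;
  pm_q1 : forall t, pm_X t ->
    (\int[lebesgue_Rd R d]_(t' in pm_X) (pm_q t t')%:E = 1)%E ;
  pm_mqw : measurable_fun (pm_X `*` pm_W) (fun p => pm_qw p.1 p.2) ;
  pm_qw_ge0 : forall t w, pm_X t -> pm_W w -> 0 <= pm_qw t w ;
  pm_qw1 : forall t, pm_X t ->
    (\int[@lebesgue_measure R]_(w in pm_W) (pm_qw t w)%:E = 1)%E ;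
  pm_qw_mean1 : forall t, pm_X t ->
    (\int[@lebesgue_measure R]_(w in pm_W) ((w : R) * pm_qw t w)%:E = 1)%E
}.

Arguments pm_mX {R d} p.
Arguments pm_mW {R d} p.
Arguments pm_mpi {R d} p.
Arguments pm_pi1 {R d} p.
Arguments pm_mq {R d} p.
Arguments pm_mqw {R d} p.

Notation pm_state R d := (Rd R d * measurableTypeR R)%type.

(* Lebesgue measure dtheta dw on R^d * R. *)
Definition pm_leb (R : realType) (d : nat) :
    {sigma_finite_measure set (pm_state R d) -> \bar R} :=
  sf_product (lebesgue_Rd R d) (@lebesgue_measure R).

Section pm.
Context (R : realType) (d : nat) (M : pm_model R d).
Local Notation T := (pm_state R d).

Definition pm_space : set T := pm_X M `*` pm_W M.

(* Division by 0 yields 0 here and in [pm_accept]. This only concerns moves that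
   are never proposed (q(t' | t) = 0) and states of null stationary mass
   (pi(t) = 0 or w = 0). *)
Definition mh_ratio (t t' : Rd R d) : R :=
  (pm_pi M t' * pm_q M t' t) / (pm_pi M t * pm_q M t t').

(* Equal to (1 / pi(t)) * \int pi(t') q(t | t') dt' as soon as pi(t) > 0 and
   almost every t' with pi(t') q(t | t') > 0 can be proposed from t. May be
   +oo. *)
Definition mean_ratio (t : Rd R d) : \bar R :=
  (\int[lebesgue_Rd R d]_(t' in pm_X M) (pm_q M t t' * mh_ratio t t')%:E)%E.

Definition pm_nu (t : Rd R d) (w : measurableTypeR R) : R := w * pm_qw M t w.

Definition pm_accept (x z : T) : R :=
  Num.min 1 (mh_ratio x.1 z.1 * z.2 / x.2).

(* The densities of the stationary law and of the accepted moves vanish off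
   [pm_space], so that the kernel below, which lives on the whole ambient space,
   is the identity kernel outside of [pm_space]. *)
Definition pm_density : T -> R :=
  (fun x : T => pm_pi M x.1 * pm_nu x.1 x.2) \_ pm_space.

Definition pm_move_density : T * T -> R :=
  (fun p : T * T =>
     pm_q M p.1.1 p.2.1 * pm_qw M p.2.1 p.2.2 * pm_accept p.1 p.2)
    \_ (pm_space `*` pm_space).

Definition pm_move (x : T) (A : set T) : \bar R :=
  (\int[pm_leb R d]_(z in A) (pm_move_density (x, z))%:E)%E.

Definition pm_trans (x : T) (A : set T) : \bar R :=
  (pm_move x A + (1 - pm_move x setT) * \d_x A)%E.

Definition pm_target (A : set T) : \bar R :=
  (\int[pm_leb R d]_(x in A) (pm_density x)%:E)%E.

Lemma measurable_pm_space : measurable pm_space.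
Proof. by apply: measurableX; [exact: pm_mX|exact: pm_mW]. Qed.

Lemma pm_density_ge0 x : 0 <= pm_density x.
Proof.
rewrite /pm_density patchE; case: ifPn => // /[!inE] -[Xx Wx].
by rewrite !mulr_ge0 ?(pm_pi_ge0 Xx) ?(pm_W_ge0 Wx) ?(pm_qw_ge0 Xx Wx).
Qed.

Lemma mh_ratio_ge0 t t' : pm_X M t -> pm_X M t' -> 0 <= mh_ratio t t'.
Proof.
move=> Xt Xt'; rewrite /mh_ratio divr_ge0// mulr_ge0//.
- exact: pm_pi_ge0.
- exact: pm_q_ge0.
- exact: pm_pi_ge0.
- exact: pm_q_ge0.
Qed.

Lemma pm_accept_ge0 x z : pm_space x -> pm_space z -> 0 <= pm_accept x z.
Proof.
move=> -[Xx Wx] -[Xz Wz]; rewrite /pm_accept le_min ler01/=.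
apply: divr_ge0; last exact: (pm_W_ge0 Wx).
by apply: mulr_ge0; [exact: mh_ratio_ge0|exact: (pm_W_ge0 Wz)].
Qed.

Lemma pm_move_density_ge0 p : 0 <= pm_move_density p.
Proof.
rewrite /pm_move_density patchE; case: ifPn => // /[!inE] -[/= xS zS].
rewrite !mulr_ge0 ?pm_accept_ge0//.
  by case: xS zS => [? _] [? _]; exact: pm_q_ge0.
by case: zS => ? ?; exact: pm_qw_ge0.
Qed.

Lemma measurable_pm_density : measurable_fun setT pm_density.
Proof.
apply/(measurable_restrictT _ measurable_pm_space).
have mS := measurable_pm_space.
apply: measurable_funM.
  apply: (measurable_comp (pm_mX M) _ (pm_mpi M) (g := fst)) => //.
    by move=> _ [x [Xx _] <-].
  by apply: measurable_funTS; exact: measurable_fst.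
rewrite /pm_nu; apply: (measurable_funM (f := snd : T -> R)).
  by apply: measurable_funTS; exact: measurable_snd.
exact: (pm_mqw M).
Qed.

Lemma measurable_pm_move_density : measurable_fun setT pm_move_density.
Proof.
have mS := measurable_pm_space.
have mX := pm_mX M.
have mSS : measurable (pm_space `*` pm_space) by exact: measurableX.
have mXX : measurable (pm_X M `*` pm_X M) by exact: measurableX.
apply/(measurable_restrictT _ mSS).
have m11 : measurable_fun setT (fun p : T * T => p.1.1).
  exact: measurableT_comp.
have m21 : measurable_fun setT (fun p : T * T => p.2.1).
  exact: measurableT_comp.
have m12 : measurable_fun setT (fun p : T * T => p.1.2).
  exact: measurableT_comp.
have m22 : measurable_fun setT (fun p : T * T => p.2.2).
  exact: measurableT_comp.
have mq : measurable_fun (pm_space `*` pm_space)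
    (fun p : T * T => pm_q M p.1.1 p.2.1).
  apply: (measurable_comp mXX _ (pm_mq M) (g := fun p : T * T => (p.1.1, p.2.1))).
    by move=> _ [[[? ?] [? ?]] [[? ?] [? ?]] <-].
  by apply: measurable_funTS; exact: measurable_fun_pair.
have mq' : measurable_fun (pm_space `*` pm_space)
    (fun p : T * T => pm_q M p.2.1 p.1.1).
  apply: (measurable_comp mXX _ (pm_mq M) (g := fun p : T * T => (p.2.1, p.1.1))).
    by move=> _ [[[? ?] [? ?]] [[? ?] [? ?]] <-].
  by apply: measurable_funTS; exact: measurable_fun_pair.
have mpi1 : measurable_fun (pm_space `*` pm_space)
    (fun p : T * T => pm_pi M p.1.1).
  apply: (measurable_comp mX _ (pm_mpi M) (g := fun p : T * T => p.1.1)).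
    by move=> _ [[[? ?] [? ?]] [[? ?] [? ?]] <-].
  by apply: measurable_funTS.
have mpi2 : measurable_fun (pm_space `*` pm_space)
    (fun p : T * T => pm_pi M p.2.1).
  apply: (measurable_comp mX _ (pm_mpi M) (g := fun p : T * T => p.2.1)).
    by move=> _ [[[? ?] [? ?]] [[? ?] [? ?]] <-].
  by apply: measurable_funTS.
have mqw : measurable_fun (pm_space `*` pm_space)
    (fun p : T * T => pm_qw M p.2.1 p.2.2).
  apply: (measurable_comp mS _ (pm_mqw M) (g := fun p : T * T => p.2)).
    by move=> _ [[[? ?] [? ?]] [[? ?] [? ?]] <-].
  by apply: measurable_funTS; exact: measurable_snd.
apply: measurable_funM; first exact: measurable_funM.
apply: measurable_minr => //.
apply: measurable_funM; first apply: measurable_funM.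
- apply: measurable_funM; first exact: measurable_funM.
  by apply: measurable_fun_invr; exact: measurable_funM.
- by apply: measurable_funTS.
- by apply: measurable_fun_invr; by apply: measurable_funTS.
Qed.


Lemma pm_leb_tonelli (f : T -> \bar R) : measurable_fun setT f ->
  (forall x, 0 <= f x)%E ->
  (\int[pm_leb R d]_x f x =
   \int[lebesgue_Rd R d]_t \int[@lebesgue_measure R]_w f (t, w))%E.
Proof.
move=> mf f0.
exact: (@fubini_tonelli1 _ _ _ _ _ (lebesgue_Rd R d) (@lebesgue_measure R)).
Qed.

Lemma measurable_pm_q t : pm_X M t -> measurable_fun (pm_X M) (pm_q M t).
Proof.
move=> Xt; have mXX := measurableX (pm_mX M) (pm_mX M).
apply: (measurable_comp mXX _ (pm_mq M) (g := fun t' => (t, t'))).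
  by move=> _ [t' Xt' <-].
by apply: measurable_funTS; exact: measurable_pair1.
Qed.

Lemma measurable_pm_qw t : pm_X M t -> measurable_fun (pm_W M) (pm_qw M t).
Proof.
move=> Xt; have mXW := measurableX (pm_mX M) (pm_mW M).
apply: (measurable_comp mXW _ (pm_mqw M) (g := fun w => (t, w))).
  by move=> _ [w Ww <-].
by apply: measurable_funTS; exact: measurable_pair1.
Qed.

Lemma pm_move_setT_le1 x : (pm_move x setT <= 1)%E.
Proof.
have [xS|xS] := pselect (pm_space x); last first.
  rewrite /pm_move integral0_eq ?lee01// => z _.
  by rewrite /pm_move_density patchE memNset// => -[/= ].
have [Xx Wx] := xS.
have mX := pm_mX M; have mW := pm_mW M.
have macc : measurable_fun setT (fun z : T => (pm_move_density (x, z))%:E).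
  apply/measurable_EFinP.
  apply: (measurableT_comp measurable_pm_move_density).
  exact: measurable_pair1.
rewrite /pm_move pm_leb_tonelli//; last first.
  by move=> z; rewrite lee_fin pm_move_density_ge0.
rewrite -(pm_q1 Xx) [leRHS]integral_mkcond.
apply: ge0_le_integral => //=.
- by move=> t _; apply: integral_ge0 => w _; rewrite lee_fin pm_move_density_ge0.
- apply: (measurable_fun_fubini_tonelli_F (m2 := @lebesgue_measure R)
    (fun z : T => (pm_move_density (x, z))%:E)) => // z.
  by rewrite lee_fin pm_move_density_ge0.
- apply/(measurable_restrictT _ mX); apply/measurable_EFinP.
  exact: measurable_pm_q.
- move=> t _; rewrite patchE; case: ifPn => [/[!inE] Xt|Xt]; last first.
    rewrite integral0_eq// => w _; rewrite /pm_move_density patchE memNset//.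
    by move=> [_ [/= Xt' _]]; move: Xt; rewrite notin_setE; apply.
  rewrite -[leRHS]mule1 -(pm_qw1 Xt) -ge0_integralZl//; last 3 first.
  + by apply/measurable_EFinP; exact: measurable_pm_qw.
  + by move=> w Ww; rewrite lee_fin pm_qw_ge0.
  + by rewrite lee_fin pm_q_ge0.
  rewrite [leRHS]integral_mkcond; apply: ge0_le_integral => //=.
  + by move=> w _; rewrite lee_fin pm_move_density_ge0.
  + exact: (measurableT_comp macc (measurable_pair1 t)).
  + apply/(measurable_restrictT _ mW); apply: measurable_funeM.
    by apply/measurable_EFinP; exact: measurable_pm_qw.
  + move=> w _; rewrite /pm_move_density !patchE.
    case: ifPn => [/[!inE] -[/= _ [/= _ Ww]]|_].
      rewrite mem_set// -EFinM lee_fin ler_piMr ?mulr_ge0 ?pm_q_ge0 ?pm_qw_ge0//.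
      by rewrite /pm_accept ge_min lexx.
    case: ifPn => // /[!inE] Ww.
    by rewrite -EFinM lee_fin mulr_ge0 ?pm_q_ge0 ?pm_qw_ge0.
Qed.

Lemma pm_target_setT : pm_target setT = 1%E.
Proof.
rewrite /pm_target pm_leb_tonelli; last 2 first.
- by apply/measurable_EFinP; exact: measurable_pm_density.
- by move=> z; rewrite lee_fin pm_density_ge0.
rewrite -(pm_pi1 M) [RHS]integral_mkcond; apply: eq_integral => t _.
rewrite patchE; case: ifPn => [/[!inE] Xt|Xt]; last first.
  rewrite integral0_eq// => w _; rewrite /pm_density patchE memNset//.
  by move=> [/= Xt' _]; move: Xt; rewrite notin_setE; apply.
rewrite -[RHS]mule1 -(pm_qw_mean1 Xt) -ge0_integralZl//; last 4 first.
- exact: pm_mW.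
- apply/measurable_EFinP.
  apply: (measurable_funM (f := id : measurableTypeR R -> R)).
    by apply: measurable_funTS; exact: measurable_id.
  exact: measurable_pm_qw.
- by move=> w Ww; rewrite lee_fin mulr_ge0 ?(pm_W_ge0 Ww)// (pm_qw_ge0 Xt Ww).
- by rewrite lee_fin pm_pi_ge0.
rewrite [RHS]integral_mkcond; apply: eq_integral => w _.
rewrite /pm_density !patchE; case: ifPn => [/[!inE] -[/= _ Ww]|tw].
  by rewrite mem_set.
case: ifPn => // /[!inE] Ww; exfalso.
by move: tw; rewrite notin_setE; apply.
Qed.

Let measurable_pm_move_density1 x :
  measurable_fun setT (fun z => pm_move_density (x, z)).
Proof.
apply: (measurableT_comp measurable_pm_move_density).
exact: measurable_pair1.
Qed.

Section move.
Variable x : T.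

Let pm_move0 : pm_move x set0 = 0%E.
Proof. by rewrite /pm_move integral_set0. Qed.

Let pm_move_ge0 A : (0 <= pm_move x A)%E.
Proof. by apply: integral_ge0 => z _; rewrite lee_fin pm_move_density_ge0. Qed.

Let pm_move_sigma_additive : semi_sigma_additive (pm_move x).
Proof.
apply: density_sigma_additive => // z; exact: pm_move_density_ge0.
Qed.

HB.instance Definition _ := isMeasure.Build _ _ _ (pm_move x)
  pm_move0 pm_move_ge0 pm_move_sigma_additive.

End move.

Let pm_move_fin x : pm_move x setT \is a fin_num.
Proof.
rewrite ge0_fin_numE; first exact: le_lt_trans (pm_move_setT_le1 x) (ltry _).
exact: measure_ge0.
Qed.

Section trans.
Variable x : T.

Let pm_trans0 : pm_trans x set0 = 0%E.
Proof. by rewrite /pm_trans /pm_move integral_set0 measure0 mule0 adde0. Qed.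

Let pm_trans_ge0 A : (0 <= pm_trans x A)%E.
Proof.
rewrite /pm_trans adde_ge0// mule_ge0//.
by rewrite sube_ge0 ?pm_move_setT_le1 ?pm_move_fin.
Qed.

Let pm_trans_sigma_additive : semi_sigma_additive (pm_trans x).
Proof.
have c0 : 0 <= fine (1 - pm_move x setT)%E.
  by apply: fine_ge0; rewrite sube_ge0 ?pm_move_setT_le1 ?pm_move_fin.
have -> : pm_trans x = measure_add (pm_move x) (mscale (NngNum c0) \d_x).
  apply/funext => A; rewrite measure_addE /pm_trans; congr (_ + _)%E.
  rewrite /mscale/=; congr (_ * _)%E.
  by rewrite -[LHS]fineK// fin_numB pm_move_fin.
exact: measure_semi_sigma_additive.
Qed.

HB.instance Definition _ := isMeasure.Build _ _ _ (pm_trans x)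
  pm_trans0 pm_trans_ge0 pm_trans_sigma_additive.

End trans.

Definition pm_kernel (x : T) : {measure set T -> \bar R} := pm_trans x.

Let measurable_pm_kernel U : measurable U ->
  measurable_fun [set: T] (pm_kernel ^~ U).
Proof.
move=> mU; have macc A : measurable A -> measurable_fun setT (pm_move ^~ A).
  move=> mA.
  have -> : pm_move ^~ A = (fun x =>
      \int[pm_leb R d]_z (pm_move_density (x, z) * \1_A z)%:E)%E.
    apply/funext => x; rewrite /pm_move integral_mkcond.
    apply: eq_integral => z _; rewrite patchE indicE.
    by case: ifPn => _; rewrite ?mulr1 ?mulr0.
  apply: (measurable_fun_fubini_tonelli_F (m2 := pm_leb R d)
    (fun p : T * T => (pm_move_density p * \1_A p.2)%:E)).
    apply/measurable_EFinP; apply: measurable_funM.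
      exact: measurable_pm_move_density.
    exact: (measurableT_comp (measurable_indic mA) measurable_snd).
  by move=> p; rewrite lee_fin mulr_ge0 ?pm_move_density_ge0 ?indicE.
rewrite /pm_kernel/= /pm_trans; apply: emeasurable_funD; first exact: macc.
apply: emeasurable_funM; first by apply: emeasurable_funB => //; exact: macc.
exact: measurable_fun_dirac.
Qed.

HB.instance Definition _ := isKernel.Build _ _ _ _ _ pm_kernel
  measurable_pm_kernel.

Let pm_kernel_setT x : pm_kernel x setT = 1%E.
Proof.
by rewrite /pm_kernel /= /pm_trans diracT mule1 addeC subeK// pm_move_fin.
Qed.

HB.instance Definition _ := Kernel_isProbability.Build _ _ _ _ _ pm_kernel
  pm_kernel_setT.

Let pm_target0 : pm_target set0 = 0%E.
Proof. by rewrite /pm_target integral_set0. Qed.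

Let pm_target_ge0 A : (0 <= pm_target A)%E.
Proof. by apply: integral_ge0 => x _; rewrite lee_fin pm_density_ge0. Qed.

Let pm_target_sigma_additive : semi_sigma_additive pm_target.
Proof.
apply: density_sigma_additive; first exact: measurable_pm_density.
exact: pm_density_ge0.
Qed.

HB.instance Definition _ := isMeasure.Build _ _ _ pm_target
  pm_target0 pm_target_ge0 pm_target_sigma_additive.

HB.instance Definition _ :=
  Measure_isProbability.Build _ _ _ pm_target pm_target_setT.

Definition pm_stationary : probability T R := pm_target.

End pm.

Section markov.
Context d (T : measurableType d) (R : realType).
Local Open Scope ereal_scope.

Definition L2_0 (mu : probability T R) : set (T -> R) :=
  [set f | f \in Lfun mu 2%:E /\ 'E_mu[f] = 0].

(* Meaningful when [mu] is stationary for [Q]. *)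
Definition left_spectral_gap (mu : probability T R) (Q : R.-pker T ~> T) :
    \bar R :=
  1 + ereal_inf [set \int[mu]_x \int[Q x]_y (f x * f y)%:E |
    f in [set f | L2_0 mu f /\ 'N[mu]_2%:E[EFin \o f] = 1]].

(* [X 0] has law [mu], and the conditional law of [X n.+1] given
   [X 0, ..., X n] is [Q (X n)]; the latter is tested on the pi-system of
   cylinders generating the sigma-algebra of [X 0, ..., X n]. *)
Definition markov_chain dO (Omega : measurableType dO) (P : probability Omega R)
    (mu : probability T R) (Q : R.-pker T ~> T) (X : nat -> {RV P >-> T}) :=
  (forall A, measurable A -> distribution P (X 0%N) A = mu A) /\
  (forall (n : nat) (A : nat -> set T) (B : set T),
    (forall i, measurable (A i)) -> measurable B ->
    let C := \bigcap_(i < n.+1) (X i @^-1` A i) in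
    P (C `&` X n.+1 @^-1` B) = \int[P]_(w in C) Q (X n w) B).

Definition scaled_mean_variance dO (Omega : measurableType dO)
    (P : probability Omega R) (X : nat -> {RV P >-> T}) (h : T -> R) (n : nat) :
    \bar R :=
  n%:R%:E * 'V_P[(fun w => n%:R^-1 * \sum_(i < n) h (X i w))%R].

Definition asymptotic_variance dO (Omega : measurableType dO)
    (P : probability Omega R) (X : nat -> {RV P >-> T}) (h : T -> R) : \bar R :=
  limn (scaled_mean_variance X h).

End markov.

(* Main.v *)
Require Import Defs.
From HB Require Import structures.
From mathcomp Require Import all_boot all_order all_algebra.
From mathcomp Require Import all_classical all_reals all_analysis.
From mathcomp Require Import measurable_realfun ring lra.

(* Write [Q] for the kernel, [c_k = <h, Q^k h>] for the autocovariances and [E]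
   for the Dirichlet form [E f = <f, f> - <f, Q f>]. The scaled variance of the
   empirical mean is the Cesaro mean of [s_m = c_0 + 2 (c_1 + ... + c_m)]. The
   even autocovariances are nonnegative and nonincreasing, and the left gap
   yields [c_2k + c_(2k+1) >= eps c_2k]; hence [s_m] tends to some
   [l] in ]-oo, +oo]. When [l] is finite, nonnegativity of [E] at
   [f - (h + Q h + ... + Q^(2m-1) h)] gives, for every [f] in L2,
     [l >= 2 (2 <h, f> - E f) - <h, h>].
   Taking [f = t h] with [E h <= (2 - eps) <h, h>] yields
   [l >= eps / (2 - eps) <h, h>]. Taking [f = phi h / 2] with [phi] increasing to
   [w / r], together with [E f <= 2 <a f, f>] and [a <= r / w] for the acceptance
   probability [a], yields [l >= - <h, h> + \int h^2 w / r]. The average of these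
   two bounds implies the theorem because [eps <= 2]. *)

Set Implicit Arguments.
Unset Strict Implicit.
Unset Printing Implicit Defensive.

Import Order.TTheory GRing.Theory Num.Theory.
Import numFieldNormedType.Exports.

Local Open Scope classical_set_scope.
Local Open Scope ring_scope.

(** * Autocovariances of a self-adjoint contraction *)

(** Neither a spectral measure nor an inverse of [1 - Q] is used: the Neumann series of [h] is cut
    after an even number [N] of terms, and everything is read off the numbers [c_k]. Cutting leaves
    two remainders. The term [<G, Q^N h>], with [G] the partial sum, has a sign because [N] is even;
    the term [<f, Q^N h>] is at most [|f| sqrt c_2N], and the gap forces [c_2N] to vanish when the
    [s_m] stay bounded. Vectors are genuine functions, not classes modulo null sets, and a kernel
    integral may be infinite on a null set. The operator is therefore not linear pointwise, and the
    form is only semidefinite. The abstract part assumes just a symmetric form with [-1 <= Q <= 1]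
    in the sense of quadratic forms; the linearity it needs is recovered inside the form. *)

Lemma cesaro_pinfty (R : realType) (u : R ^nat) :
  u @ \oo --> +oo -> arithmetic_mean u @ \oo --> +oo.
Proof.
move=> /cvgryPge uoo; apply/cvgryPge => A.
have [N _ uN] := uoo (`|A| + 1).
pose C := series u N - N%:R * (`|A| + 1).
(* The slope exceeds [|A|] by one, and this surplus eventually absorbs the constant [C]. *)
have seriesu n : (N <= n)%N -> C + n%:R * (`|A| + 1) <= series u n.
  elim: n => [|n IH].
    by rewrite leqn0 => /eqP N0; rewrite /C N0 !mul0r subr0 addr0.
  rewrite leq_eqVlt => /predU1P[<-|]; first by rewrite /C subrK.
  rewrite ltnS => Nn; rewrite seriesSr -natr1 mulrDl mul1r addrA.
  by apply: lerD; [exact: IH|exact: uN].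
near=> n; rewrite /arithmetic_mean /= ler_pdivlMl ?ltr0n//.
have Nn : (N <= n.+1)%N by apply: leqW; near: n; exact: nbhs_infty_ge.
apply: le_trans (seriesu _ Nn); rewrite mulrDr mulr1.
have : `|C| <= n.+1%:R.
  apply: le_trans (_ : n%:R <= _); last by rewrite ler_nat.
  by near: n; exact: nbhs_infty_ger.
have : n.+1%:R * A <= n.+1%:R * `|A| by rewrite ler_wpM2l// ler_norm.
have := ler_norm (- C); rewrite normrN.
lra.
Unshelve. all: by end_near. Qed.

Section selfadjoint_contraction.
Context (R : realType) (V : lmodType R) (ip : V -> V -> R) (Q : V -> V).
Hypothesis ipC : forall u v, ip u v = ip v u.
Hypothesis ipl : forall a u v w, ip (a *: u + v) w = a * ip u w + ip v w.
Hypothesis ip_ge0 : forall u, 0 <= ip u u.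
Hypothesis ipQ : forall u v, ip u (Q v) = ip v (Q u).
Hypothesis ipQ_le : forall u, ip u (Q u) <= ip u u.
Hypothesis ipQ_ge : forall u, - ip u u <= ip u (Q u).

Definition dirichlet u := ip u u - ip u (Q u).

Let ipDl u v w : ip (u + v) w = ip u w + ip v w.
Proof. by rewrite -[u]scale1r ipl mul1r scale1r. Qed.

Let ip0l w : ip 0 w = 0.
Proof. by have := ipDl 0 0 w; rewrite addr0; lra. Qed.

Let ipZl a u w : ip (a *: u) w = a * ip u w.
Proof. by rewrite -[a *: u]addr0 ipl ip0l addr0. Qed.

Let ipDr u v w : ip w (u + v) = ip w u + ip w v.
Proof. by rewrite ipC ipDl !(ipC w). Qed.

Let ipZr a u w : ip w (a *: u) = a * ip w u.
Proof. by rewrite ipC ipZl (ipC w). Qed.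

Let ipr_sum n (F : nat -> V) w :
  ip w (\sum_(k < n) F k) = \sum_(k < n) ip w (F k).
Proof.
elim: n => [|n IH]; first by rewrite !big_ord0 ipC ip0l.
by rewrite !big_ord_recr/= ipDr IH.
Qed.

(** [Q] is additive only against a test vector, where symmetry moves it to the other argument. *)
Let ipQDr u v w : ip w (Q (u + v)) = ip w (Q u) + ip w (Q v).
Proof. by rewrite ipQ ipDl !(ipQ w). Qed.

Let ipQZr a u w : ip w (Q (a *: u)) = a * ip w (Q u).
Proof. by rewrite ipQ ipZl (ipQ w). Qed.

Let ipQr_sum n (F : nat -> V) w :
  ip w (Q (\sum_(k < n) F k)) = \sum_(k < n) ip w (Q (F k)).
Proof. by rewrite ipQ ipC ipr_sum; apply: eq_bigr => k _; rewrite ipC ipQ. Qed.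

Let ipBB u v t : ip (u - t *: v) (u - t *: v) =
  ip u u - 2 * t * ip u v + t ^+ 2 * ip v v.
Proof.
rewrite -scaleNr !(ipDl, ipDr, ipZl, ipZr) (ipC v u); ring.
Qed.

Let ipQBB u v t : ip (u - t *: v) (Q (u - t *: v)) =
  ip u (Q u) - 2 * t * ip u (Q v) + t ^+ 2 * ip v (Q v).
Proof.
rewrite -scaleNr !(ipDl, ipQDr, ipZl, ipQZr) (ipQ v u); ring.
Qed.

Lemma young_ip u v (t : R) : 0 < t ->
  2 * ip u v <= t * ip u u + t^-1 * ip v v.
Proof.
move=> t0; have := ip_ge0 (u - t^-1 *: v); rewrite ipBB => H.
have {}H := mulr_ge0 (ltW t0) H.
have E : t * (ip u u - 2 * t^-1 * ip u v + t^-1 ^+ 2 * ip v v) =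
    t * ip u u - 2 * ip u v + t^-1 * ip v v.
  by field; rewrite gt_eqF.
by rewrite E in H; lra.
Qed.

(** Take the upper form bound at [Q u + u] and the lower one at [Q u - u]: the unknown
    [<Q u, Q Q u>] and the terms [<u, Q u>] cancel. *)
Lemma ipQ_contract u : ip (Q u) (Q u) <= ip u u.
Proof.
have := ipQ_le (Q u - (-1) *: u); have := ipQ_ge (Q u - 1 *: u).
rewrite !ipBB !ipQBB (ipC (Q u) u); lra.
Qed.

Variable h : V.

Definition autocov k := ip h (iter k Q h).

Definition autocov_sum m := autocov 0 + 2 * \sum_(k < m) autocov k.+1.

Let autocovD i j : ip (iter i Q h) (iter j Q h) = autocov (i + j).
Proof.
elim: i j => // i IH j; rewrite iterS ipC ipQ.
by rewrite -iterS IH addSnnS.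
Qed.

Let autocov_even_ge0 k : 0 <= autocov k.*2.
Proof. by rewrite -addnn -autocovD. Qed.

Let autocov_even_nincr k : autocov k.+1.*2 <= autocov k.*2.
Proof. by rewrite -!addnn -!autocovD iterS ipQ_contract. Qed.

Let autocov_even_le0 k : autocov k.*2 <= autocov 0.
Proof.
elim: k => [//|k]; exact/le_trans/autocov_even_nincr.
Qed.

(** An odd autocovariance is the quadratic form of [Q] at the iterate [Q^k h]. *)
Let autocov_odd k : `|autocov k.*2.+1| <= autocov k.*2.
Proof.
rewrite -addnn -addnS -!autocovD iterS ler_norml.
by rewrite ipQ_ge ipQ_le.
Qed.

Let autocov_sum_incr m : autocov_sum m.+1 = autocov_sum m + 2 * autocov m.+1.
Proof. by rewrite /autocov_sum big_ord_recr/=; ring. Qed.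

Let autocov_sumE m : \sum_(k < m.+1) autocov k = (autocov_sum m + autocov 0) / 2.
Proof. by rewrite /autocov_sum big_ord_recl/= /bump/=; field. Qed.

Variables (eps : R).
Hypothesis eps_gt0 : 0 < eps.
(** Required along the iterates of [h] only: these stay centred, whereas [V] will also contain test
    functions with nonzero mean. *)
Hypothesis gap :
  forall k, let u := iter k Q h in (eps - 1) * ip u u <= ip u (Q u).

(** Stopping at an odd index groups [c_2k] with [c_(2k+1)]; odd terms may be negative, but each pair
    is nonnegative. *)
Let p m := autocov_sum m.*2.+1.

Let gap_pair k : eps * autocov k.*2 <= autocov k.*2 + autocov k.*2.+1.
Proof.
have := gap k; rewrite /= -iterS !autocovD addnS addnn; lra.
Qed.

Let p_incr m : p m + 2 * eps * autocov m.+1.*2 <= p m.+1.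
Proof.
rewrite /p doubleS !autocov_sum_incr.
have := gap_pair m.+1; rewrite doubleS; lra.
Qed.

Let p_nd : nondecreasing_seq p.
Proof.
apply/nondecreasing_seqP => m; apply: le_trans (p_incr m).
by rewrite lerDl !mulr_ge0// ltW.
Qed.

Let autocov_sum_near_p n :
  `|autocov_sum n - p n./2| <= 2 * autocov n./2.*2.
Proof.
rewrite -{1}[n]odd_double_half /p; case: (odd n) => /=.
  by rewrite add1n subrr normr0 mulr_ge0.
rewrite add0n autocov_sum_incr opprD addrA subrr sub0r normrN normrM.
by rewrite ger0_norm// ler_wpM2l.
Qed.

Lemma half_cvg : half n @[n --> \oo] --> \oo.
Proof.
move=> A [N _ NA]; exists N.*2 => // n /= Nn; apply: NA => /=.
by rewrite -(doubleK N) half_leq.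
Qed.

(** [G] solves the Poisson equation [G - Q G = h] up to [Q^N h]. Expand the Dirichlet form at
    [G - f]; Young's inequality with the free parameter [t] pays for [<f, Q^N h>], and
    [<Q^N h, Q^N h> = c_2N]. *)
Let variational_bound f m (t : R) : 0 < t ->
  2 * ip h f - dirichlet f <= (p m + autocov 0) / 2 +
    t * ip f f + t^-1 * autocov m.+1.*2.*2.
Proof.
move=> t0; pose N := m.+1.*2; pose G := \sum_(k < N) iter k Q h.
have telescope g : ip g G - ip g (Q G) = ip g h - ip g (iter N Q h).
  rewrite /G ipQr_sum ipr_sum -sumrB.
  rewrite -(big_mkord xpredT
    (fun k => ip g (iter k Q h) - ip g (iter k.+1 Q h))).
  have := telescope_sumr (fun k => - ip g (iter k Q h)) (leq0n N).
  rewrite opprK addrC => <-.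
  by apply: eq_bigr => k _; rewrite opprK addrC.
(* The last index is [N - 1 = 2 m + 1], the one at which [p m] stops. *)
have hG : ip h G = (p m + autocov 0) / 2.
  by rewrite /G ipr_sum -autocov_sumE /N doubleS.
(* As [N] is even, the terms [c_(N+i)] split into pairs starting at an even index, each
   nonnegative. *)
have GN : 0 <= ip G (iter N Q h).
  rewrite ipC /G ipr_sum; under eq_bigr do rewrite autocovD.
  suff pair n k : 0 <= \sum_(i < n.*2) autocov (k.*2 + i) by exact: pair.
  elim: n => [|n IH]; first by rewrite big_ord0.
  rewrite doubleS 2!big_ord_recr/= -addrA addr_ge0// addnS -doubleD.
  by have := autocov_odd (k + n); rewrite ler_norml => /andP[+ _]; lra.
have := ipQ_le (G - 1 *: f); rewrite ipBB ipQBB.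
have := telescope G; have := telescope f.
rewrite !expr1n !(ipC G f) (ipQ G f) (ipC G h) (ipC f h) /dirichlet.
have := young_ip f (iter N Q h) t0.
rewrite autocovD addnn -/N hG; lra.
Qed.

Lemma autocov_sum_cvg :
  autocov_sum @ \oo --> +oo \/
  exists l, autocov_sum @ \oo --> l /\
    forall f, 2 * (2 * ip h f - dirichlet f) - autocov 0 <= l.
Proof.
have [[B pB]|pub] := pselect (exists B, forall m, p m <= B); last first.
  left; apply/cvgryPge => A.
  (* The slack [2 c_0] covers the distance from [autocov_sum n] to [p n./2]. *)
  have [N pN] : exists N, A + 2 * autocov 0 <= p N.
    apply: contrapT => /forallNP pA; apply: pub; exists (A + 2 * autocov 0) => m.
    by have /negP := pA m; rewrite -ltNge => /ltW.
  exists N.*2 => // n /= Nn.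
  have := p_nd (half_leq Nn); rewrite doubleK.
  have := autocov_sum_near_p n; have := autocov_even_le0 n./2.
  rewrite ler_norml => + /andP[+ _]; lra.
right.
have pcvg : cvgn p.
  apply: nondecreasing_is_cvgn => //; exists B => _ [m _ <-]; exact: pB.
exists (limn p).
(* The gap enters here: the increments of the convergent [p] dominate [2 eps c_(2k+2)]. *)
have c0 : autocov k.*2 @[k --> \oo] --> (0 : R).
  rewrite -cvg_shiftS/=.
  apply: (@squeeze_cvgr _ _ _ _ (cst 0)
    (fun k => (2 * eps)^-1 * (p k.+1 - p k))).
  - near=> k; apply/andP; split; first exact: autocov_even_ge0.
    rewrite ler_pdivlMl ?mulr_gt0//; have := p_incr k; lra.
  - exact: cvg_cst.
  - rewrite [X in _ --> X](_ : _ = (2 * eps)^-1 * (limn p - limn p)); last first.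
      by rewrite subrr mulr0.
    by apply: cvgMr; apply: cvgB => //; rewrite cvg_shiftS.
split.
  have ph : p n./2 @[n --> \oo] --> limn p.
    exact: (cvg_comp _ _ half_cvg pcvg).
  have ch : 2 * autocov n./2.*2 @[n --> \oo] --> (0 : R).
    rewrite -[X in _ --> X](mulr0 2); apply: cvgMr.
    exact: (cvg_comp _ _ half_cvg c0).
  apply: (@squeeze_cvgr _ _ _ _ (fun n => p n./2 - 2 * autocov n./2.*2)
    (fun n => p n./2 + 2 * autocov n./2.*2)).
  - near=> n; have := autocov_sum_near_p n.
    rewrite ler_norml; lra.
  - by rewrite -[X in _ --> X]subr0; exact: cvgB.
  - by rewrite -[X in _ --> X]addr0; exact: cvgD.
move=> f.
suff : 2 * ip h f - dirichlet f <= (limn p + autocov 0) / 2 by lra.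
apply/ler_addgt0Pr => e e0.
(* Once [c_(4(M+1)) <= t^2], the error is at most [t <f, f> + t = e]. *)
pose t := e / (ip f f + 1).
have f0 := ip_ge0 f; have f1 : 0 < ip f f + 1 by lra.
have t0 : 0 < t by rewrite divr_gt0.
have [M _ cM] : \forall k \near \oo, autocov k.*2 < t ^+ 2.
  by apply: (cvgr_lt _ c0); rewrite exprn_gt0.
apply: le_trans (variational_bound f M t0) _.
have pl : p M <= limn p by exact: nondecreasing_cvgn_le.
have MM : (M <= M.+1.*2)%N by rewrite -addnn ltnW// ltn_addr.
have := cM _ MM; rewrite /= => /ltW.
rewrite -(ler_pM2l (_ : 0 < t^-1)) ?invr_gt0//.
rewrite expr2 mulrA mulVf ?gt_eqF// mul1r.
have <- : t * ip f f + t = e by rewrite /t; field; rewrite gt_eqF.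
lra.
Unshelve. all: by end_near. Qed.

End selfadjoint_contraction.

Local Open Scope ereal_scope.

(** * Functionals on nonnegative measurable functions *)

Section ge0_functional.
Import HBNNSimple.
Context d (T : measurableType d) (R : realType).
Implicit Types (Phi : (T -> \bar R) -> \bar R) (f g : T -> \bar R).

Definition ge0_mfun f := measurable_fun setT f /\ forall x, 0 <= f x.

(** The properties of integration that carry an identity from indicators to nonnegative measurable
    functions. Functionals, rather than measures, also include evaluations and mixtures, so density
    formulas and the Markov property share one argument. *)
Record ge0_functional Phi := {
  ge0_functional_ge0 : forall f, ge0_mfun f -> 0 <= Phi f ;
  ge0_functionalD : forall f g, ge0_mfun f -> ge0_mfun g ->
    Phi (fun x => f x + g x) = Phi f + Phi g ;
  ge0_functionalZ : forall (k : R) f, (0 <= k)%R -> ge0_mfun f ->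
    Phi (fun x => k%:E * f x) = k%:E * Phi f ;
  ge0_functional_homo : forall f g, ge0_mfun f -> ge0_mfun g ->
    (forall x, f x <= g x) -> Phi f <= Phi g ;
  ge0_functional_cvg : forall (F : (T -> \bar R)^nat) f,
    (forall n, ge0_mfun (F n)) ->
    (forall x, nondecreasing_seq (F ^~ x)) ->
    (forall x, F ^~ x @ \oo --> f x) -> Phi (F n) @[n --> \oo] --> Phi f }.

Lemma ge0_functional_unique Phi Psi : ge0_functional Phi -> ge0_functional Psi ->
  (forall A, measurable A ->
    Phi (fun x => (\1_A x)%:E) = Psi (fun x => (\1_A x)%:E)) ->
  forall f, ge0_mfun f -> Phi f = Psi f.
Proof.
move=> HPhi HPsi eq1.
have g1 A : measurable A -> ge0_mfun (fun x => (\1_A x)%:E).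
  move=> mA; split=> [|x]; last by rewrite lee_fin.
  by apply/measurable_EFinP; exact: measurable_indic.
have gi (k : R) A : (0 <= k)%R -> measurable A ->
    ge0_mfun (fun x => k%:E * (\1_A x)%:E).
  move=> k0 mA; split; last by move=> x; rewrite mule_ge0// lee_fin.
  by apply: measurable_funeM; exact: (g1 _ mA).1.
have eq_sum (s : seq (R * set T)) :
    (forall i, i \in s -> (0 <= i.1)%R /\ measurable i.2) ->
    let S := fun x => \sum_(i <- s) i.1%:E * (\1_i.2 x)%:E in
    ge0_mfun S /\ Phi S = Psi S.
  elim: s => [_ S|[k A] s IH /= sP].
    (* The value at the zero function comes from homogeneity with factor 0. *)
    have -> : S = (fun x => 0%R%:E * (\1_(@set0 T) x)%:E).
      by apply/funext => x; rewrite /S big_nil mul0e.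
    split; first exact: gi.
    by rewrite (ge0_functionalZ HPhi)//; [rewrite (ge0_functionalZ HPsi)//;
      [rewrite !mul0e|exact: g1]|exact: g1].
  have /= [k0 mA] := sP (k, A) (mem_head _ _).
  have [|gS eS] := IH; first by move=> i si; apply: sP; rewrite in_cons si orbT.
  under eq_fun do rewrite big_cons /=.
  split; first by split=> [|x];
    [apply: emeasurable_funD; [exact: (gi k A k0 mA).1|exact: gS.1]
    |rewrite adde_ge0//; [exact: (gi k A k0 mA).2|exact: gS.2]].
  have gA := gi k A k0 mA.
  rewrite (ge0_functionalD HPhi gA gS) (ge0_functionalD HPsi gA gS).
  by rewrite eS (ge0_functionalZ HPhi k0 (g1 _ mA))
    (ge0_functionalZ HPsi k0 (g1 _ mA)) eq1.
have eq_nnsfun (f : {nnsfun T >-> R}) : Phi (EFin \o f) = Psi (EFin \o f).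
  (* The maximum makes every coefficient visibly nonnegative and changes nothing on the range of
     [f]. *)
  pose s := [seq (Num.max r 0%R, f @^-1` [set r]) |
    r <- finmap.enum_fset (fset_set (range f))].
  have -> : EFin \o f = fun x => \sum_(i <- s) i.1%:E * (\1_i.2 x)%:E.
    apply/funext => x; rewrite /s big_map /= fimfunE fsbig_finite//=.
    rewrite -sumEFin big_seq [RHS]big_seq; apply: eq_bigr => r.
    rewrite in_fset_set// inE => -[y _ <-].
    by rewrite max_l.
  apply: (eq_sum _ _).2 => i /mapP[r _ ->]/=; split; last first.
    by [].
  by rewrite le_max lexx orbT.
move=> f [mf f0].
pose F n x := (nnsfun_approx measurableT mf n x)%:E.
have gF n : ge0_mfun (F n).
  by split=> [|x]; [apply/measurable_EFinP|rewrite lee_fin].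
have ndF x : nondecreasing_seq (F ^~ x).
  by move=> m n mn; rewrite lee_fin; exact/lefP/nd_nnsfun_approx.
have Ff x : F ^~ x @ \oo --> f x by exact: cvg_nnsfun_approx.
have /cvg_lim <-// := ge0_functional_cvg HPhi gF ndF Ff.
have /cvg_lim <-// := ge0_functional_cvg HPsi gF ndF Ff.
by congr (limn _); apply/funext => n; exact: eq_nnsfun.
Qed.

Lemma ge0_functional_eval x : ge0_functional (fun f => f x).
Proof. by split=> // f []. Qed.

Lemma ge0_functional_integral (mu : {measure set T -> \bar R}) :
  ge0_functional (fun f => \int[mu]_x f x).
Proof.
split.
- by move=> f [mf f0]; exact: integral_ge0.
- by move=> f g [mf f0] [mg g0]; rewrite ge0_integralD.
- by move=> k f k0 [mf f0]; rewrite ge0_integralZl_EFin.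
- by move=> f g [mf f0] [mg g0] fg; exact: ge0_le_integral.
- move=> F f gF ndF Ff.
  have -> : \int[mu]_x f x = \int[mu]_x limn (F ^~ x).
    by apply: eq_integral => x _; apply/esym/cvg_lim.
  apply: cvg_monotone_convergence => //.
  + by move=> n; exact: (gF n).1.
  + by move=> n x _; exact: (gF n).2.
Qed.

End ge0_functional.

Section ge0_functional_mixture.
Context d (T : measurableType d) d' (U : measurableType d') (R : realType).
Variables (m : {measure set U -> \bar R}) (w : U -> R).
Variable L : U -> (T -> \bar R) -> \bar R.
Hypothesis mw : measurable_fun setT w.
Hypothesis w0 : forall u, (0 <= w u)%R.
Hypothesis fL : forall u, ge0_functional (L u).
Hypothesis mL : forall f, ge0_mfun f -> measurable_fun setT (L ^~ f).

(** [L u] will be an evaluation for densities, and for chains an evaluation at, or a kernel integral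
    from, a random state. *)
Lemma ge0_functional_mixture :
  ge0_functional (fun f => \int[m]_u ((w u)%:E * L u f)).
Proof.
have mwL f : ge0_mfun f -> measurable_fun setT (fun u => (w u)%:E * L u f).
  by move=> gf; apply: emeasurable_funM; [exact/measurable_EFinP|exact: mL].
have wL0 f u : ge0_mfun f -> 0 <= (w u)%:E * L u f.
  by move=> gf; rewrite mule_ge0 ?lee_fin// (ge0_functional_ge0 (fL u)).
split.
- by move=> f gf; apply: integral_ge0 => u _; exact: wL0.
- move=> f g gf gg; rewrite -ge0_integralD//; last 4 first.
    by move=> u _; exact: wL0.
    exact: mwL.
    by move=> u _; exact: wL0.
    exact: mwL.
  apply: eq_integral => u _.
  by rewrite (ge0_functionalD (fL u))// muleDr// ge0_adde_def//
    inE (ge0_functional_ge0 (fL u)).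
- move=> k f k0 gf; rewrite -ge0_integralZl_EFin//; last 2 first.
    by move=> u _; exact: wL0.
    exact: mwL.
  by apply: eq_integral => u _; rewrite (ge0_functionalZ (fL u))// muleCA.
- move=> f g gf gg fg; apply: ge0_le_integral => //.
  + by move=> u _; exact: wL0.
  + exact: mwL.
  + exact: mwL.
  + move=> u _; apply: lee_wpmul2l; first by rewrite lee_fin.
    exact: (ge0_functional_homo (fL u)).
- move=> F f gF ndF Ff.
  have -> : \int[m]_u ((w u)%:E * L u f) =
      \int[m]_u limn (fun n => (w u)%:E * L u (F n)).
    apply: eq_integral => u _; apply/esym/cvg_lim => //.
    by apply: cvgeZl => //; exact: (ge0_functional_cvg (fL u)).
  apply: cvg_monotone_convergence => //.
  + by move=> n; exact: mwL.
  + by move=> n u _; exact: wL0.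
  + move=> u _ a b ab; apply: lee_wpmul2l; first by rewrite lee_fin.
    by apply: (ge0_functional_homo (fL u)) => // x; exact: ndF.
Qed.

End ge0_functional_mixture.

Lemma ge0_integral_density d (T : measurableType d) (R : realType)
    (mu nu : {measure set T -> \bar R}) (w : T -> R) :
  measurable_fun setT w -> (forall x, (0 <= w x)%R) ->
  (forall A, measurable A -> nu A = \int[mu]_(x in A) (w x)%:E) ->
  forall f, ge0_mfun f -> \int[nu]_x f x = \int[mu]_x ((w x)%:E * f x).
Proof.
move=> mw w0 nuE; apply: ge0_functional_unique.
- exact: ge0_functional_integral.
- apply: (ge0_functional_mixture mu mw w0 (L := fun u f => f u)) => //.
  + by move=> u; exact: ge0_functional_eval.
  + by move=> f [].
- move=> A mA; rewrite integral_indic// setIT nuE// integral_mkcond.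
  apply: eq_integral => x _; rewrite patchE indicE.
  by case: ifPn => _; rewrite ?mule1 ?mule0.
Qed.

(** * The L2 inner product *)

(* Locked, so that [lra] does not unfold integrals when comparing atoms. *)
HB.lock Definition inner_prod d (T : measurableType d) (R : realType)
  (mu : {measure set T -> \bar R}) (f g : T -> R) : R :=
  (\int[mu]_x (f x * g x))%R.
Canonical inner_prod_unlockable := Unlockable inner_prod.unlock.

Section inner_product.
Context d (T : measurableType d) (R : realType) (mu : {measure set T -> \bar R}).
Implicit Types f g : T -> R.
Local Notation L2 := (Lfun mu 2%:E).
Local Notation inner_prod := (inner_prod mu).

Lemma Lfun2P f : f \in L2 <->
  measurable_fun setT f /\ \int[mu]_x ((f x) ^+ 2)%:E < +oo.
Proof.
split.
  move=> L2f; split; first by move/sub_Lfun_mfun : L2f; rewrite inE.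
  by have /integrable_lty := Lfun2_integrable_sqr L2f; exact.
move=> [mf foo]; apply/andP; split; first by rewrite inE.
rewrite inE/= /finite_norm unlock/= poweR_lty//.
apply: le_lt_trans foo; apply: ge0_le_integral => //.
- apply/measurable_EFinP; apply: (@measurableT_comp _ _ _ _ _ _ (@powR R ^~ 2)%R) => //.
  exact: measurableT_comp.
- by apply/measurable_EFinP; exact: measurable_funX.
- by move=> x _; rewrite lee_fin powR_mulrn// real_normK// num_real.
Qed.

Lemma Lfun2_measurable f : f \in L2 -> measurable_fun setT f.
Proof. by move=> /Lfun2P[]. Qed.

Lemma Lfun2_le f g : measurable_fun setT f -> g \in L2 ->
  (forall x, `|f x| <= `|g x|)%R -> f \in L2.
Proof.
move=> mf /Lfun2P[mg goo] fg; apply/Lfun2P; split => //.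
apply: le_lt_trans goo; apply: ge0_le_integral => //.
- by move=> x _; rewrite lee_fin sqr_ge0.
- by apply/measurable_EFinP; exact: measurable_funX.
- by apply/measurable_EFinP; exact: measurable_funX.
- move=> x _; rewrite lee_fin -real_normK ?num_real//.
  by rewrite -(real_normK (num_real (g x))) lerXn2r// nnegrE.
Qed.

Lemma Lfun2Z (k : R) f : f \in L2 -> (fun x => k * f x)%R \in L2.
Proof.
move=> L2f; rewrite (_ : (fun x => _) = k \o* f)%R ?Lfun_scale ?ler1n//.
by apply/funext => x /=; rewrite mulrC.
Qed.

Lemma Lfun2B f g : f \in L2 -> g \in L2 -> (fun x => f x - g x)%R \in L2.
Proof.
move=> L2f L2g; rewrite -[X in X \in _]/(f - g)%R.
by rewrite rpredB ?lee1n.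
Qed.

Lemma inner_prod_integrable f g : f \in L2 -> g \in L2 ->
  mu.-integrable setT (fun x => (f x * g x)%:E).
Proof. by move=> L2f L2g; exact/Lfun1_integrable/Lfun2_mul_Lfun1. Qed.

Lemma inner_prodE f g : f \in L2 -> g \in L2 ->
  (inner_prod f g)%:E = \int[mu]_x (f x * g x)%:E.
Proof.
by move=> L2f L2g; rewrite unlock fineK// integrable_fin_num//
  inner_prod_integrable.
Qed.

Lemma inner_prodC f g : inner_prod f g = inner_prod g f.
Proof. rewrite unlock; by apply: eq_Rintegral => x _; rewrite mulrC. Qed.

Lemma inner_prod_ge0 f g : (forall x, 0 <= f x * g x)%R -> (0 <= inner_prod f g)%R.
Proof. by move=> fg; rewrite unlock; exact: Rintegral_ge0. Qed.

Lemma inner_prodZl (a : R) f g : f \in L2 -> g \in L2 ->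
  inner_prod (fun x => a * f x)%R g = (a * inner_prod f g)%R.
Proof.
move=> L2f L2g; rewrite unlock -RintegralZl//; last exact: inner_prod_integrable.
by apply: eq_Rintegral => x _; rewrite mulrA.
Qed.

Lemma inner_prod_linearl (a : R) f g h : f \in L2 -> g \in L2 -> h \in L2 ->
  inner_prod (fun x => a * f x + g x)%R h =
  (a * inner_prod f h + inner_prod g h)%R.
Proof.
move=> L2f L2g L2h; rewrite unlock -RintegralZl//; last exact: inner_prod_integrable.
rewrite -RintegralD//; last 2 first.
  exact: (integrableZl measurableT a (inner_prod_integrable L2f L2h)).
  exact: inner_prod_integrable.
by apply: eq_Rintegral => x _; rewrite mulrDl mulrA.
Qed.

Lemma inner_prodBl f g h : f \in L2 -> g \in L2 -> h \in L2 ->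
  inner_prod (fun x => f x - g x)%R h = (inner_prod f h - inner_prod g h)%R.
Proof.
move=> L2f L2g L2h; rewrite addrC -mulN1r -inner_prod_linearl//.
by congr inner_prod; apply/funext => x; rewrite mulN1r addrC.
Qed.

Lemma inner_prodBr f g h : f \in L2 -> g \in L2 -> h \in L2 ->
  inner_prod h (fun x => f x - g x)%R = (inner_prod h f - inner_prod h g)%R.
Proof. by move=> *; rewrite inner_prodC inner_prodBl// !(inner_prodC h). Qed.

Lemma Lnorm2_sqr f : f \in L2 ->
  'N[mu]_2%:E[EFin \o f] ^+ 2 = (inner_prod f f)%:E.
Proof.
move=> L2f; have Nfin : 'N[mu]_2%:E[EFin \o f] \is a fin_num.
  by move: L2f => /andP[_]; rewrite inE/= ge0_fin_numE ?Lnorm_ge0.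
have := @powR_Lnorm _ _ _ mu (EFin \o f) 2; rewrite -(fineK Nfin) poweR_EFin.
rewrite powR_mulrn ?fine_ge0 ?Lnorm_ge0// EFin_expe => -> //.
rewrite inner_prodE//; apply: eq_integral => x _ /=.
by rewrite powR_mulrn// real_normK// ?num_real// expr2.
Qed.

Lemma Lfun2_funrpos f : f \in L2 -> (f^\+)%R \in L2.
Proof.
move=> L2f; apply: (Lfun2_le _ L2f).
  exact/measurable_funrpos/Lfun2_measurable.
move=> x; rewrite ger0_norm ?funrpos_ge0// /funrpos.
by rewrite ge_max normr_ge0 ler_norm.
Qed.

Lemma Lfun2_funrneg f : f \in L2 -> (f^\-)%R \in L2.
Proof.
move=> L2f; apply: (Lfun2_le _ L2f).
  exact/measurable_funrneg/Lfun2_measurable.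
move=> x; rewrite ger0_norm ?funrneg_ge0// /funrneg.
by rewrite ge_max normr_ge0 -normrN ler_norm.
Qed.

Lemma Lfun2_mul01 (a : T -> R) f : measurable_fun setT a ->
  (forall x, 0 <= a x <= 1)%R -> f \in L2 -> (fun x => a x * f x)%R \in L2.
Proof.
move=> ma a01 L2f; apply: (Lfun2_le _ L2f).
  by apply: measurable_funM => //; exact: Lfun2_measurable.
move=> x; have /andP[a0 a1] := a01 x.
by rewrite normrM (ger0_norm a0) ler_piMl.
Qed.

(* The cross term vanishes since [f^\+ * f^\- = 0]. *)
Lemma inner_prod_funrposneg (a : T -> R) f : measurable_fun setT a ->
  (forall x, 0 <= a x <= 1)%R -> f \in L2 ->
  inner_prod f (fun x => a x * f x)%R =
  (inner_prod f^\+ (fun x => a x * f^\+ x) +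
   inner_prod f^\- (fun x => a x * f^\- x))%R.
Proof.
move=> ma a01 L2f; have L2p := Lfun2_funrpos L2f; have L2n := Lfun2_funrneg L2f.
rewrite unlock -RintegralD//; last 2 first.
- by apply: inner_prod_integrable => //; exact: Lfun2_mul01.
- by apply: inner_prod_integrable => //; exact: Lfun2_mul01.
apply: eq_Rintegral => x _; rewrite /funrpos /funrneg.
have [f0|f0] := lerP 0%R (f x).
  by rewrite max_r ?oppr_le0// mul0r addr0.
by rewrite max_l ?oppr_ge0 ?ltW//; ring.
Qed.

Lemma inner_prod_sqr_funrposneg f : f \in L2 ->
  inner_prod f f = (inner_prod f^\+ f^\+ + inner_prod f^\- f^\-)%R.
Proof.
move=> L2f; have := @inner_prod_funrposneg (cst 1%R) f.
have E (g : T -> R) : (fun x => cst 1 x * g x)%R = g.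
  by apply/funext => x; rewrite mul1r.
rewrite !E; apply => // x; by rewrite /cst ler01 lexx.
Qed.

End inner_product.

(** Total mass one is not imposed, so that the notion covers both a Markov kernel and its accepted
    moves alone. *)
Definition reversible d (T : measurableType d) (R : realType)
    (mu : {measure set T -> \bar R}) (K : T -> {measure set T -> \bar R}) :=
  forall f g : T -> \bar R, ge0_mfun f -> ge0_mfun g ->
    \int[mu]_x (g x * \int[K x]_y f y) = \int[mu]_x (f x * \int[K x]_y g y).

Section reversible_cross_term.
Context d (T : measurableType d) (R : realType) (mu : {measure set T -> \bar R}).
Variable K : T -> {measure set T -> \bar R}.
Hypothesis mK : forall U, measurable U -> measurable_fun setT (K ^~ U).
Hypothesis revK : reversible mu K.
Variable a : T -> R.
Hypothesis KT : forall x, K x setT = (a x)%:E.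

(** Integrate [2 g(x) f(y) <= g(x)^2 + f(y)^2] against [mu(dx) K(x, dy)], both of whose marginals
    are [a mu]. With [a = 1] this gives the form bounds on [Q]; with [a] the acceptance probability,
    the sharper Dirichlet bound. *)
Lemma reversible_cross_term (f g : T -> R) :
  measurable_fun setT f -> measurable_fun setT g ->
  (forall x, 0 <= f x)%R -> (forall x, 0 <= g x)%R ->
  2%:E * \int[mu]_x ((g x)%:E * \int[K x]_y (f y)%:E) <=
  \int[mu]_x (g x * (a x * g x))%:E + \int[mu]_x (f x * (a x * f x))%:E.
Proof.
move=> mf mg f0 g0.
have ma : measurable_fun setT (EFin \o a).
  rewrite (_ : EFin \o a = K ^~ setT); first exact: mK.
  by apply/funext => x /=; rewrite KT.
have a0 x : (0 <= a x)%R by rewrite -lee_fin -KT.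
have gf : ge0_mfun (fun x => (f x)%:E).
  by split=> [|x]; [exact/measurable_EFinP|rewrite lee_fin].
have gf2 : ge0_mfun (fun x => (f x ^+ 2)%:E).
  by split=> [|x]; [apply/measurable_EFinP; exact: measurable_funX|
    rewrite lee_fin sqr_ge0].
have mKf u : ge0_mfun u -> measurable_fun setT (fun x => \int[K x]_y u y).
  by move=> [mu_ u0]; exact: measurable_fun_integral_kernel.
(* Reversibility against the constant 1 identifies the second marginal. *)
have rev1 : \int[mu]_x (f x * (a x * f x))%:E = \int[mu]_x \int[K x]_y (f y ^+ 2)%:E.
  have g1 : ge0_mfun (cst 1 : T -> \bar R) by split.
  have := revK gf2 g1; under eq_integral do rewrite mul1e.
  move=> ->; apply: eq_integral => x _.
  by rewrite integral_cst// mul1e KT -EFinM expr2; congr EFin; ring.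
have mgag : measurable_fun setT (fun x => (g x * (a x * g x))%:E).
  apply/measurable_EFinP; apply: measurable_funM => //; apply: measurable_funM => //.
  exact/measurable_EFinP.
rewrite rev1 -ge0_integralD//; last 3 first.
- by move=> x _; rewrite lee_fin !mulr_ge0.
- by move=> x _; apply: integral_ge0 => y _; exact: gf2.2.
- exact: mKf.
rewrite -ge0_integralZl_EFin//; last 2 first.
- by move=> x _; rewrite mule_ge0 ?lee_fin// integral_ge0// => y _; rewrite lee_fin.
- by apply: emeasurable_funM; [exact/measurable_EFinP|exact: mKf].
have mgKf : measurable_fun setT (fun x => 2%:E * ((g x)%:E * \int[K x]_y (f y)%:E)).
  by apply: measurable_funeM; apply: emeasurable_funM;
    [exact/measurable_EFinP|exact: mKf].
apply: ge0_le_integral => //.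
- move=> x _; rewrite !mule_ge0 ?lee_fin// integral_ge0// => y _.
  by rewrite lee_fin.
- by apply: emeasurable_funD => //; exact: mKf.
move=> x _.
have -> : (g x * (a x * g x))%:E = \int[K x]_y (g x ^+ 2)%:E.
  by rewrite integral_cst// KT -EFinM expr2; congr EFin; ring.
rewrite -ge0_integralD//; last 3 first.
- by move=> y _; rewrite lee_fin sqr_ge0.
- by move=> y _; exact: gf2.2.
- exact: gf2.1.
rewrite muleA -EFinM -ge0_integralZl_EFin//; last 3 first.
- by move=> y _; rewrite lee_fin.
- exact/measurable_EFinP.
- by rewrite mulr_ge0.
apply: ge0_le_integral => //.
- by move=> y _; rewrite lee_fin !mulr_ge0.
- by apply: measurable_funeM; exact/measurable_EFinP.
- by apply: emeasurable_funD => //; exact: gf2.1.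
move=> y _; rewrite -EFinD -EFinM lee_fin.
have := sqr_ge0 (g x - f y); rewrite sqrrB; lra.
Qed.

End reversible_cross_term.

(** * Reversible kernels as operators on L2 *)

Section kernel_operator.
Context d (T : measurableType d) (R : realType).
Variable Q : R.-pker T ~> T.
Implicit Types f g : T -> R.

Definition kernel_pos f x : R := fine (\int[Q x]_y (f y)%:E).

(* Equal to [\int[Q x]_y f y] for almost every [x] when [f] is integrable with
   respect to a stationary law; this form is exactly additive in the positive
   and negative parts. *)
Definition kernel_op f x : R := (kernel_pos f^\+ x - kernel_pos f^\- x)%R.

Lemma measurable_kernel_integral (f : T -> \bar R) : ge0_mfun f ->
  measurable_fun setT (fun x => \int[Q x]_y f y).
Proof.
move=> [mf f0]; apply: measurable_fun_integral_kernel => //.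
exact: measurable_kernel.
Qed.

Lemma ge0_mfun_EFin f : measurable_fun setT f -> (forall x, 0 <= f x)%R ->
  ge0_mfun (EFin \o f).
Proof. by move=> mf f0; split=> [|x]; [exact/measurable_EFinP|rewrite lee_fin]. Qed.

Lemma kernel_pos_ge0 f : (forall x, 0 <= f x)%R ->
  forall x, (0 <= kernel_pos f x)%R.
Proof. by move=> f0 x; rewrite fine_ge0// integral_ge0// => y _; rewrite lee_fin. Qed.

Lemma measurable_kernel_pos f : measurable_fun setT f -> (forall x, 0 <= f x)%R ->
  measurable_fun setT (kernel_pos f).
Proof.
move=> mf f0; apply: (measurableT_comp (fine_measurable measurableT)).
exact/measurable_kernel_integral/ge0_mfun_EFin.
Qed.

(** Jensen's inequality, by integrating [2 M f <= f^2 + M^2] with [M] the mean. *)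
Lemma sqr_kernel_pos_le f x : measurable_fun setT f -> (forall x, 0 <= f x)%R ->
  (kernel_pos f x ^+ 2)%:E <= \int[Q x]_y (f y ^+ 2)%:E.
Proof.
move=> mf f0; set M := kernel_pos f x.
have M0 : (0 <= M)%R := kernel_pos_ge0 f0 x.
have mf2 : measurable_fun setT (fun y => (f y ^+ 2)%:E : \bar R).
  by apply/measurable_EFinP; exact: measurable_funX.
(* Only an inequality: an infinite integral gives [M = 0] through [fine]. *)
have Mf : M%:E <= \int[Q x]_y (f y)%:E.
  rewrite /M /kernel_pos; case E : (\int[Q x]_y (f y)%:E) => [r| |]/=;
    [by []|by rewrite leey|].
  have : 0 <= \int[Q x]_y (f y)%:E by apply: integral_ge0 => y _; rewrite lee_fin.
  by rewrite E.
have : \int[Q x]_y ((2 * M)%:E * (f y)%:E) <=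
    \int[Q x]_y ((f y ^+ 2)%:E + (M ^+ 2)%:E).
  apply: ge0_le_integral => //.
  - by move=> y _; rewrite mule_ge0// lee_fin// mulr_ge0.
  - by apply: measurable_funeM; exact/measurable_EFinP.
  - exact: emeasurable_funD.
  - move=> y _; rewrite -EFinM -EFinD lee_fin.
    by have := sqr_ge0 (f y - M); rewrite sqrrB; lra.
rewrite ge0_integralZl_EFin//; last 3 first.
- by move=> y _; rewrite lee_fin.
- exact/measurable_EFinP.
- by rewrite mulr_ge0.
rewrite ge0_integralD//; last 2 first.
- by move=> y _; rewrite lee_fin sqr_ge0.
- by move=> y _; rewrite lee_fin sqr_ge0.
rewrite integral_cst// prob_kernel mule1 => H.
have {}H : (2 * M * M)%:E <= \int[Q x]_y (f y ^+ 2)%:E + (M ^+ 2)%:E.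
  apply: le_trans H; rewrite [leLHS]EFinM lee_wpmul2l//.
  by rewrite lee_fin mulr_ge0.
have M2E : (M ^+ 2)%:E = (2 * M * M)%:E - (M ^+ 2)%:E.
  by rewrite -EFinB; congr EFin; ring.
by rewrite M2E leeBlDr.
Qed.

End kernel_operator.

Section reversible_kernel.
Context d (T : measurableType d) (R : realType).
Variables (mu : probability T R) (Q : R.-pker T ~> T).
Hypothesis revQ : reversible mu Q.
Implicit Types f g : T -> R.
Local Notation L2 := (Lfun mu 2%:E).
Local Notation ip := (inner_prod mu).

Let Q1 x : Q x setT = (cst 1%R x)%:E.
Proof. exact: prob_kernel. Qed.

Let mQ U : measurable U -> measurable_fun setT (Q ^~ U).
Proof. exact: measurable_kernel. Qed.

Lemma reversible_stationary (f : T -> \bar R) : ge0_mfun f ->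
  \int[mu]_x \int[Q x]_y f y = \int[mu]_x f x.
Proof.
move=> gf; have g1 : ge0_mfun (cst 1 : T -> \bar R) by split.
have := revQ gf g1.
under eq_integral do rewrite mul1e.
move=> ->; apply: eq_integral => x _.
by rewrite integral_cst// mul1e Q1 mule1.
Qed.

Definition nnegL2 f := f \in L2 /\ forall x, (0 <= f x)%R.

Lemma nnegL2_mfun f : nnegL2 f -> ge0_mfun (EFin \o f).
Proof. by move=> [/Lfun2_measurable mf f0]; exact: ge0_mfun_EFin. Qed.

(** By stationarity the integral over [mu] equals that of [f], finite because L2 lies in L1 for a
    probability; infinite values thus fill a null set. *)
Lemma integral_kernel_ae_fin f : nnegL2 f ->
  {ae mu, forall x, \int[Q x]_y (f y)%:E = (kernel_pos Q f x)%:E}.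
Proof.
move=> nf; have gf := nnegL2_mfun nf; have [L2f f0] := nf.
have : mu.-integrable setT (fun x => \int[Q x]_y (f y)%:E).
  apply/integrableP; split; first exact: measurable_kernel_integral.
  under eq_integral => x _.
    rewrite gee0_abs; last by apply: integral_ge0 => y _; rewrite lee_fin.
    over.
  rewrite (reversible_stationary gf).
  have /Lfun1_integrable : f \in Lfun mu 1.
    by rewrite Lfun_subset12// fin_num_measure.
  by move=> /integrable_lty; apply.
move=> /(integrable_ae measurableT); apply: filterS => x /(_ I) H.
by rewrite /kernel_pos fineK.
Qed.

Lemma kernel_pos_L2 f : nnegL2 f -> nnegL2 (kernel_pos Q f).
Proof.
move=> [L2f f0]; split; last exact: kernel_pos_ge0.
have [mf foo] := (Lfun2P _ _).1 L2f.
apply/Lfun2P; split; first exact: measurable_kernel_pos.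
apply: le_lt_trans foo.
have gf2 : ge0_mfun (EFin \o (fun x => f x ^+ 2))%R.
  by apply: ge0_mfun_EFin => [|x]; [exact: measurable_funX|exact: sqr_ge0].
rewrite -(reversible_stationary gf2); apply: ge0_le_integral => //.
- by move=> x _; rewrite lee_fin sqr_ge0.
- by apply/measurable_EFinP; apply: measurable_funX; exact: measurable_kernel_pos.
- exact: measurable_kernel_integral.
- by move=> x _; exact: sqr_kernel_pos_le.
Qed.

Let b g f := ip g (kernel_pos Q f).

Lemma kernel_posE f g : nnegL2 f -> nnegL2 g ->
  (b g f)%:E = \int[mu]_x ((g x)%:E * \int[Q x]_y (f y)%:E).
Proof.
move=> nf ng; have [[L2f f0] [L2g g0]] := (nf, ng).
have [L2k k0] := kernel_pos_L2 nf.
have gf := nnegL2_mfun nf.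
rewrite inner_prodE//; apply: ae_eq_integral => //.
- apply/measurable_EFinP; apply: measurable_funM; exact: (Lfun2_measurable (mu := mu)).
- apply: emeasurable_funM; last exact: measurable_kernel_integral.
  by apply/measurable_EFinP; exact: (Lfun2_measurable (mu := mu)).
- by have := integral_kernel_ae_fin nf; apply: filterS => x -> _; rewrite EFinM.
Qed.

Lemma kernel_pos_sym f g : nnegL2 f -> nnegL2 g -> b g f = b f g.
Proof.
move=> nf ng; apply: EFin_inj; rewrite (kernel_posE nf ng) (kernel_posE ng nf).
exact: (revQ (nnegL2_mfun nf) (nnegL2_mfun ng)).
Qed.

Lemma inner_kernel_pos_ge0 f g : nnegL2 f -> nnegL2 g -> (0 <= b g f)%R.
Proof.
move=> nf [_ g0]; apply: inner_prod_ge0 => x; rewrite mulr_ge0//.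
exact: (kernel_pos_L2 nf).2.
Qed.

Lemma inner_kernel_pos_le f g : nnegL2 f -> nnegL2 g -> (2 * b g f <= ip g g + ip f f)%R.
Proof.
move=> nf ng; rewrite -lee_fin EFinM (kernel_posE nf ng) [leRHS]EFinD.
have [[L2f f0] [L2g g0]] := (nf, ng).
have := reversible_cross_term mQ revQ Q1
  (Lfun2_measurable L2f) (Lfun2_measurable L2g) f0 g0.
move=> /le_trans; apply; rewrite !inner_prodE//.
by apply: leeD; under eq_integral do rewrite mul1r.
Qed.

Lemma nnegL2_funrpos f : f \in L2 -> nnegL2 (f^\+)%R.
Proof. by move=> L2f; split=> [|x]; [exact: Lfun2_funrpos|exact: funrpos_ge0]. Qed.

Lemma nnegL2_funrneg f : f \in L2 -> nnegL2 (f^\-)%R.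
Proof. by move=> L2f; split=> [|x]; [exact: Lfun2_funrneg|exact: funrneg_ge0]. Qed.

Lemma kernel_op_L2 f : f \in L2 -> kernel_op Q f \in L2.
Proof.
move=> L2f.
have [L2p _] := kernel_pos_L2 (nnegL2_funrpos L2f).
have [L2n _] := kernel_pos_L2 (nnegL2_funrneg L2f).
exact: Lfun2B.
Qed.

Lemma kernel_opE f g : f \in L2 -> g \in L2 ->
  ip g (kernel_op Q f) = (b g^\+ f^\+ - b g^\- f^\+ - (b g^\+ f^\- - b g^\- f^\-))%R.
Proof.
move=> L2f L2g.
have [L2p _] := kernel_pos_L2 (nnegL2_funrpos L2f).
have [L2n _] := kernel_pos_L2 (nnegL2_funrneg L2f).
have gpn : g = (fun x => g^\+ x - g^\- x)%R.
  by rewrite -[LHS]funrposBneg.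
have [[L2gp _] [L2gn _]] := (nnegL2_funrpos L2g, nnegL2_funrneg L2g).
rewrite inner_prodBr//; congr (_ - _)%R; rewrite {1}gpn inner_prodBl//.
Qed.

Lemma kernel_op_sym f g : f \in L2 -> g \in L2 ->
  ip g (kernel_op Q f) = ip f (kernel_op Q g).
Proof.
move=> L2f L2g; rewrite (kernel_opE L2f L2g) (kernel_opE L2g L2f).
have pf := nnegL2_funrpos L2f; have nf := nnegL2_funrneg L2f.
have pg := nnegL2_funrpos L2g; have ng := nnegL2_funrneg L2g.
have := kernel_pos_sym pf pg; have := kernel_pos_sym pf ng.
have := kernel_pos_sym nf pg; have := kernel_pos_sym nf ng.
lra.
Qed.

(** Expanding over positive and negative parts, the upper bound discards the cross terms; the lower
    bound that follows discards the diagonal ones. *)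
Lemma kernel_op_le f : f \in L2 -> (ip f (kernel_op Q f) <= ip f f)%R.
Proof.
move=> L2f; rewrite (kernel_opE L2f L2f) (inner_prod_sqr_funrposneg L2f).
have pf := nnegL2_funrpos L2f; have nf := nnegL2_funrneg L2f.
have := inner_kernel_pos_ge0 pf nf; have := inner_kernel_pos_ge0 nf pf.
have := inner_kernel_pos_le pf pf; have := inner_kernel_pos_le nf nf.
lra.
Qed.

Lemma kernel_op_geN f : f \in L2 -> (- ip f f <= ip f (kernel_op Q f))%R.
Proof.
move=> L2f; rewrite (kernel_opE L2f L2f) (inner_prod_sqr_funrposneg L2f).
have pf := nnegL2_funrpos L2f; have nf := nnegL2_funrneg L2f.
have := inner_kernel_pos_ge0 pf pf; have := inner_kernel_pos_ge0 nf nf.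
have := inner_kernel_pos_le pf nf; have := inner_kernel_pos_le nf pf.
lra.
Qed.

Lemma kernel_op_cst1 : kernel_op Q (cst 1%R) = cst 1%R.
Proof.
apply/funext => x; rewrite /kernel_op /kernel_pos.
have -> : \int[Q x]_y (((cst 1)^\+)%R y)%:E = 1%E.
  under eq_integral do rewrite /funrpos max_l//.
  by rewrite (integral_cst (Q x) measurableT 1) mul1e Q1.
have -> : \int[Q x]_y (((cst 1)^\-)%R y)%:E = 0%E.
  under eq_integral do rewrite /funrneg max_r ?oppr_le0//.
  by rewrite integral0.
by rewrite subr0.
Qed.

Lemma kernel_op_mean f : f \in L2 ->
  \int[mu]_x (kernel_op Q f x)%:E = \int[mu]_x (f x)%:E.
Proof.
move=> L2f; have L2c : cst 1%R \in L2 by exact: Lfun_cst.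
have := congr1 EFin (kernel_op_sym L2f L2c).
rewrite kernel_op_cst1 (inner_prodE L2c (kernel_op_L2 L2f)) (inner_prodE L2f L2c).
under eq_integral do rewrite mul1r.
by move=> ->; apply: eq_integral => x _; rewrite mulr1.
Qed.

(** Links the double integral in [left_spectral_gap] to the operator. *)
Lemma kernel_op_quadratic f : f \in L2 ->
  \int[mu]_x \int[Q x]_y (f x * f y)%:E = (ip f (kernel_op Q f))%:E.
Proof.
move=> L2f; have mf := Lfun2_measurable L2f.
rewrite inner_prodE ?kernel_op_L2//; apply: ae_eq_integral => //.
- pose k (p : T * T) := (f p.1 * f p.2)%:E.
  have mk : measurable_fun setT k.
    by apply/measurable_EFinP; apply: measurable_funM; exact: measurableT_comp.
  have -> : (fun x => \int[Q x]_y (f x * f y)%:E) =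
      (fun x => \int[Q x]_y k^\+ (x, y) - \int[Q x]_y k^\- (x, y)).
    apply/funext => x; rewrite integralE; congr (_ - _); apply: eq_integral => y _.
      by rewrite !funeposE.
    by rewrite !funenegE.
  apply: emeasurable_funB.
    apply: (measurable_fun_integral_sfinite_kernel k^\+ Q) => //.
    exact: measurable_funepos.
  apply: (measurable_fun_integral_sfinite_kernel k^\- Q) => //.
  exact: measurable_funeneg.
- apply/measurable_EFinP; apply: measurable_funM => //.
  exact: (Lfun2_measurable (kernel_op_L2 L2f)).
have := integral_kernel_ae_fin (nnegL2_funrpos L2f).
have := integral_kernel_ae_fin (nnegL2_funrneg L2f).
apply: filterS2 => x Hn Hp _.
(* Almost surely both parts of [f] have finite integrals, so [f x] can leave the signed inner
   integral. *)
have intf : (Q x).-integrable setT (EFin \o f).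
  apply/integrableP; split; first exact/measurable_EFinP.
  have -> : \int[Q x]_y `|(EFin \o f) y| =
      \int[Q x]_y (f^\+ y)%:E + \int[Q x]_y (f^\- y)%:E.
    rewrite -ge0_integralD//; last 4 first.
    - by move=> y _; rewrite lee_fin funrpos_ge0.
    - by apply/measurable_EFinP; exact: measurable_funrpos.
    - by move=> y _; rewrite lee_fin funrneg_ge0.
    - by apply/measurable_EFinP; exact: measurable_funrneg.
    apply: eq_integral => y _ /=; rewrite -EFinD; congr EFin.
    by have /(congr1 (fun u => u y)) := funrposDneg f.
  by rewrite Hn Hp -EFinD ltry.
under eq_integral do rewrite EFinM.
rewrite integralZl// EFinM; congr (_ * _).
rewrite integralE /kernel_op EFinB; congr (_ - _).
- by rewrite -Hp funerpos.
- by rewrite -Hn funerneg.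
Qed.

End reversible_kernel.

(** * Kernels that move or stay put *)

Section rejection_kernel.
Context d (T : measurableType d) (R : realType).
Variables (mu : probability T R) (Q : R.-pker T ~> T).
Variable K : T -> {measure set T -> \bar R}.
Hypothesis mK : forall U, measurable U -> measurable_fun setT (K ^~ U).
Hypothesis revK : reversible mu K.
Variable a : T -> R.
Hypothesis KT : forall x, K x setT = (a x)%:E.
Hypothesis a_le1 : forall x, (a x <= 1)%R.
Hypothesis QE : forall x A, measurable A ->
  Q x A = K x A + (1 - a x)%:E * \d_x A.
Implicit Types f g : T -> R.
Local Notation L2 := (Lfun mu 2%:E).
Local Notation ip := (inner_prod mu).

Let a01 x : (0 <= a x <= 1)%R.
Proof. by rewrite a_le1 -lee_fin -KT measure_ge0. Qed.

Let ma : measurable_fun setT a.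
Proof.
apply/measurable_EFinP; rewrite (_ : EFin \o a = K ^~ setT); first exact: mK.
by apply/funext => x /=; rewrite KT.
Qed.

Lemma integral_rejection_kernel (f : T -> \bar R) x : ge0_mfun f ->
  \int[Q x]_y f y = \int[K x]_y f y + (1 - a x)%:E * f x.
Proof.
move=> [mf f0].
have a0 : (0 <= 1 - a x)%R by rewrite subr_ge0.
have -> : \int[Q x]_y f y =
    \int[measure_add (K x) (mscale (NngNum a0) \d_x)]_y f y.
  apply: eq_measure_integral => A mA _.
  by rewrite QE//; apply/esym; exact: measure_addE.
rewrite ge0_integral_measure_add// ge0_integral_mscale// integral_dirac//.
by rewrite diracT mul1e.
Qed.

Lemma reversible_rejection_kernel : reversible mu Q.
Proof.
move=> f g gf gg; have [mf f0] := gf; have [mg g0] := gg.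
have mKi (u : T -> \bar R) : ge0_mfun u ->
    measurable_fun setT (fun x => \int[K x]_y u y).
  by move=> [mu_ u0]; exact: measurable_fun_integral_kernel.
have splitQ (u v : T -> \bar R) : ge0_mfun u -> ge0_mfun v ->
    \int[mu]_x (v x * \int[Q x]_y u y) =
    \int[mu]_x (v x * \int[K x]_y u y) + \int[mu]_x ((1 - a x)%:E * (v x * u x)).
  move=> gu gv; have [mu_ u0] := gu; have [mv v0] := gv.
  have Ku0 x : 0 <= \int[K x]_y u y by exact: integral_ge0.
  have a0 x : 0 <= (1 - a x)%:E by rewrite lee_fin subr_ge0.
  rewrite -ge0_integralD//; last 4 first.
  - by move=> x _; rewrite mule_ge0.
  - by apply: emeasurable_funM => //; exact: mKi.
  - by move=> x _; rewrite !mule_ge0.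
  - apply: emeasurable_funM; last exact: emeasurable_funM.
    by apply/measurable_EFinP; exact: measurable_funB.
  apply: eq_integral => x _; rewrite integral_rejection_kernel//.
  rewrite ge0_muleDr//; last by rewrite mule_ge0.
  by rewrite (muleCA (v x)).
rewrite (splitQ f g gf gg) (splitQ g f gg gf) (revK gf gg); congr (_ + _).
by apply: eq_integral => x _; rewrite (muleC (f x)).
Qed.

Let revQ : reversible mu Q := reversible_rejection_kernel.

(** Keep the holding mass [1 - a] and discard the moves, whose contribution is nonnegative. *)
Let kernel_pos_diag_ge f : nnegL2 mu f ->
  (ip f f - ip f (fun x => a x * f x) <= ip f (kernel_pos Q f))%R.
Proof.
move=> nf; have [L2f f0] := nf.
have L2af : (fun x => a x * f x)%R \in L2 by exact: Lfun2_mul01.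
rewrite -inner_prodBr// -lee_fin (kernel_posE revQ nf nf).
have L2d : (fun x => f x - a x * f x)%R \in L2.
  exact: Lfun2B.
rewrite inner_prodE//; apply: ge0_le_integral => //.
- move=> x _; rewrite lee_fin mulr_ge0// -{1}[f x]mul1r -mulrBl mulr_ge0//.
  by rewrite subr_ge0.
- by apply/measurable_EFinP; apply: measurable_funM;
    [exact: (Lfun2_measurable L2f)|exact: (Lfun2_measurable L2d)].
- apply: emeasurable_funM.
    by apply/measurable_EFinP; exact: (Lfun2_measurable L2f).
  exact: measurable_kernel_integral (nnegL2_mfun nf).
- move=> x _; rewrite EFinM lee_wpmul2l ?lee_fin//.
  rewrite (integral_rejection_kernel x (nnegL2_mfun nf)).
  rewrite -{1}[f x]mul1r -mulrBl EFinM leeDr// integral_ge0// => y _.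
  by rewrite lee_fin.
Qed.

(** Disjoint supports kill the holding mass; only moves remain, and these carry the factor [a]. *)
Let kernel_pos_disjoint_le f g : nnegL2 mu f -> nnegL2 mu g -> (forall x, g x * f x = 0)%R ->
  (2 * ip g (kernel_pos Q f) <=
   ip g (fun x => a x * g x) + ip f (fun x => a x * f x))%R.
Proof.
move=> nf ng gf0; rewrite -lee_fin EFinM (kernel_posE revQ nf ng) [leRHS]EFinD.
have [[L2f f0] [L2g g0]] := (nf, ng).
have := reversible_cross_term mK revK KT
  (Lfun2_measurable L2f) (Lfun2_measurable L2g) f0 g0.
rewrite -!inner_prodE ?Lfun2_mul01// => H; apply: le_trans H.
rewrite (_ : \int[mu]_x ((g x)%:E * \int[Q x]_y (f y)%:E) =
  \int[mu]_x ((g x)%:E * \int[K x]_y (f y)%:E))//.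
apply: eq_integral => x _.
rewrite (integral_rejection_kernel x (nnegL2_mfun nf)).
rewrite ge0_muleDr; last 2 first.
- by apply: integral_ge0 => y _; rewrite lee_fin.
- by rewrite mule_ge0 ?lee_fin ?subr_ge0.
by rewrite muleCA -(EFinM (g x)) gf0 mule0 adde0.
Qed.

(** The diagonal terms of the decomposition by sign lose at most one [<f, a f>] and the cross terms
    another, hence the factor 2. *)
Lemma kernel_op_ge f : f \in L2 ->
  (ip f f - 2 * ip f (fun x => a x * f x) <= ip f (kernel_op Q f))%R.
Proof.
move=> L2f; rewrite (kernel_opE revQ L2f L2f) (inner_prod_sqr_funrposneg L2f).
rewrite (inner_prod_funrposneg ma a01 L2f).
have disj x : (f^\- x * f^\+ x = 0)%R.
  rewrite /funrpos /funrneg; have [f0|f0] := lerP 0%R (f x).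
    by rewrite max_r ?oppr_le0// mul0r.
  by rewrite mulr0.
have disj' x : (f^\+ x * f^\- x = 0)%R by rewrite mulrC.
have := kernel_pos_disjoint_le (nnegL2_funrpos L2f) (nnegL2_funrneg L2f) disj.
have := kernel_pos_disjoint_le (nnegL2_funrneg L2f) (nnegL2_funrpos L2f) disj'.
have := kernel_pos_diag_ge (nnegL2_funrpos L2f); have := kernel_pos_diag_ge (nnegL2_funrneg L2f).
lra.
Qed.

End rejection_kernel.

(** * Stationary reversible Markov chains *)

Section reversible_chain.
Context d (T : measurableType d) (R : realType).
Variables (mu : probability T R) (Q : R.-pker T ~> T).
Hypothesis revQ : reversible mu Q.
Context dO (Omega : measurableType dO).
Variables (P : probability Omega R) (X : nat -> {RV P >-> T}).
Hypothesis chainX : markov_chain mu Q X.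
Implicit Types f g : T -> R.
Local Notation L2 := (Lfun mu 2%:E).
Local Notation ip := (inner_prod mu).
Local Notation ipP := (inner_prod P).

Let mX n : measurable_fun setT (X n). Proof. by []. Qed.

Let mXpre n A : measurable A -> measurable (X n @^-1` A).
Proof. by move=> mA; rewrite -[X in measurable X]setTI; exact: mX. Qed.

Lemma markov_chain_pair i n A B : (i <= n)%N -> measurable A -> measurable B ->
  P (X i @^-1` A `&` X n.+1 @^-1` B) = \int[P]_(w in X i @^-1` A) Q (X n w) B.
Proof.
(* A cylinder that constrains coordinate [i] alone. *)
move=> iln mA mB; pose A' j := if j == i then A else setT.
have mA' j : measurable (A' j) by rewrite /A'; case: ifP.
have CE : \bigcap_(j < n.+1) (X j @^-1` A' j) = X i @^-1` A.
  apply/seteqP; split => w /=; first by move=> /(_ i iln); rewrite /= /A' eqxx.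
  by move=> Aw j _; rewrite /A'; case: eqP => [->|].
by have := chainX.2 n A' B mA' mB; rewrite /= CE.
Qed.

Let g1 (U : measurableType d) A : measurable A ->
  ge0_mfun (fun x : U => (\1_A x)%:E : \bar R).
Proof.
move=> mA; split=> [|x]; last by rewrite lee_fin.
by apply/measurable_EFinP; exact: measurable_indic.
Qed.

Lemma chain_stationary n A : measurable A -> distribution P (X n) A = mu A.
Proof.
elim: n A => [|n IH] A mA; first exact: chainX.1.
have := markov_chain_pair (leq0n n) measurableT mA.
rewrite preimage_setT setTI => H; rewrite /distribution /pushforward H.
rewrite -[LHS](@ge0_integral_distribution _ _ _ _ _ _ (X n) (fun x => Q x A))//;
  last exact: measurable_kernel.
rewrite (eq_measure_integral mu); last by move=> B mB _; exact: IH.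
transitivity (\int[mu]_x \int[Q x]_y (\1_A y)%:E).
  by apply: eq_integral => x _; rewrite integral_indic// setIT.
by rewrite (reversible_stationary revQ (g1 mA)) integral_indic// setIT.
Qed.

Lemma ge0_integral_chain n (f : T -> \bar R) : ge0_mfun f ->
  \int[P]_w f (X n w) = \int[mu]_x f x.
Proof.
move=> [mf f0]; rewrite -(ge0_integral_distribution (X n) mf f0).
by apply: eq_measure_integral => B mB _; exact: chain_stationary.
Qed.

Lemma ae_chain n (S : T -> Prop) : {ae mu, forall x, S x} ->
  {ae P, forall w, S (X n w)}.
Proof.
move=> [N [mN N0 SN]]; exists (X n @^-1` N); split; first exact: mXpre.
  by have := chain_stationary n mN; rewrite N0.
by move=> w; exact: (SN (X n w)).
Qed.

Let Qle1 x B : measurable B -> (fine (Q x B))%:E = Q x B.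
Proof.
move=> mB; rewrite fineK// ge0_fin_numE// (le_lt_trans _ (ltry 1))//.
by rewrite -(prob_kernel (s := Q) x); apply: le_measure; rewrite ?inE.
Qed.

(** The Markov property is extended one argument at a time: first the past, with [B] fixed, then the
    future in [markov_chain_ge0]. Mixture weights are real, hence [fine]. *)
Let markov_chain_indic i n B (g : T -> \bar R) : (i <= n)%N -> measurable B ->
  ge0_mfun g ->
  \int[P]_w ((\1_B (X n.+1 w))%:E * g (X i w)) =
  \int[P]_w ((fine (Q (X n w) B))%:E * g (X i w)).
Proof.
move=> iln mB; move: g; apply: ge0_functional_unique.
- apply: (@ge0_functional_mixture _ _ _ _ _ P (fun w => \1_B (X n.+1 w))
    (fun w u => u (X i w))).
  + exact: (measurableT_comp (measurable_indic mB) (mX n.+1)).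
  + by [].
  + by move=> w; exact: ge0_functional_eval.
  + by move=> u [mu_ _]; exact: (measurableT_comp mu_ (mX i)).
- apply: (@ge0_functional_mixture _ _ _ _ _ P (fun w => fine (Q (X n w) B))
    (fun w u => u (X i w))).
  + apply: (measurableT_comp (fine_measurable measurableT)).
    exact: (measurableT_comp (measurable_kernel Q B mB) (mX n)).
  + by move=> w; rewrite fine_ge0.
  + by move=> w; exact: ge0_functional_eval.
  + by move=> u [mu_ _]; exact: (measurableT_comp mu_ (mX i)).
move=> A mA; transitivity (P (X i @^-1` A `&` X n.+1 @^-1` B)).
  rewrite -[X in _ = P X]setIT -integral_indic//; last first.
    by apply: measurableI; exact: mXpre.
  apply: eq_integral => w _; rewrite -EFinM; congr EFin.
  by rewrite !indicE in_setI mulrC -natrM mulnb.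
rewrite markov_chain_pair// integral_mkcond; apply: eq_integral => w _.
rewrite patchE indicE; have -> : (w \in X i @^-1` A) = (X i w \in A) by [].
by case: ifPn => _; rewrite ?mule1 ?mule0// Qle1.
Qed.

Lemma markov_chain_ge0 i n g (f : T -> \bar R) : (i <= n)%N ->
  measurable_fun setT g -> (forall x, 0 <= g x)%R -> ge0_mfun f ->
  \int[P]_w ((g (X i w))%:E * f (X n.+1 w)) =
  \int[P]_w ((g (X i w))%:E * \int[Q (X n w)]_y f y).
Proof.
move=> iln mg g0; move: f; apply: ge0_functional_unique.
- apply: (@ge0_functional_mixture _ _ _ _ _ P (fun w => g (X i w))
    (fun w u => u (X n.+1 w))).
  + exact: (measurableT_comp mg (mX i)).
  + by [].
  + by move=> w; exact: ge0_functional_eval.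
  + by move=> u [mu_ _]; exact: (measurableT_comp mu_ (mX n.+1)).
- apply: (@ge0_functional_mixture _ _ _ _ _ P (fun w => g (X i w))
    (fun w u => \int[Q (X n w)]_y u y)).
  + exact: (measurableT_comp mg (mX i)).
  + by [].
  + by move=> w; exact: ge0_functional_integral.
  + by move=> u gu; exact: (measurableT_comp (measurable_kernel_integral Q gu) (mX n)).
move=> B mB; under eq_integral do rewrite muleC.
rewrite (markov_chain_indic iln mB (ge0_mfun_EFin mg g0)).
by apply: eq_integral => w _; rewrite integral_indic// setIT Qle1// muleC.
Qed.

Lemma Lfun2_chain n f : f \in L2 -> f \o X n \in Lfun P 2%:E.
Proof.
move=> /Lfun2P[mf foo]; apply/Lfun2P; split; first exact: measurableT_comp.
rewrite (ge0_integral_chain n (f := fun x => (f x ^+ 2)%:E))//.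
split=> [|x]; last by rewrite lee_fin sqr_ge0.
by apply/measurable_EFinP; exact: measurable_funX.
Qed.

Lemma inner_prod_chain n f g : f \in L2 -> g \in L2 ->
  ipP (g \o X n) (f \o X n) = ip g f.
Proof.
move=> L2f L2g; apply: EFin_inj.
rewrite !inner_prodE ?Lfun2_chain//.
have := @integral_distribution _ _ _ _ _ P (X n) (fun x => (g x * f x)%:E).
move=> <-.
- by apply: eq_measure_integral => B mB _; exact: chain_stationary.
- by apply/measurable_EFinP; apply: measurable_funM; exact: (Lfun2_measurable (mu := mu)).
- exact: (inner_prod_integrable (Lfun2_chain n L2g) (Lfun2_chain n L2f)).
Qed.

Let markov_pos i n f g : (i <= n)%N -> nnegL2 mu f -> nnegL2 mu g ->
  ipP (g \o X i) (f \o X n.+1) = ipP (g \o X i) (kernel_pos Q f \o X n).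
Proof.
move=> iln nf ng; have [[L2f f0] [L2g g0]] := (nf, ng).
have [L2k k0] := kernel_pos_L2 revQ nf.
apply: EFin_inj; rewrite !inner_prodE ?Lfun2_chain//.
transitivity (\int[P]_w ((g (X i w))%:E * (EFin \o f) (X n.+1 w))).
  by apply: eq_integral => w _; rewrite EFinM.
rewrite (markov_chain_ge0 iln (Lfun2_measurable L2g) g0 (nnegL2_mfun nf)).
apply: ae_eq_integral => //.
- apply: emeasurable_funM.
    by apply/measurable_EFinP; exact: (Lfun2_measurable (Lfun2_chain i L2g)).
  exact: (measurableT_comp (measurable_kernel_integral Q (nnegL2_mfun nf)) (mX n)).
- by apply/measurable_EFinP; apply: measurable_funM;
    [exact: (Lfun2_measurable (Lfun2_chain i L2g))|
     exact: (Lfun2_measurable (Lfun2_chain n L2k))].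
- have := ae_chain n (integral_kernel_ae_fin revQ nf).
  by apply: filterS => w /= H _; rewrite H EFinM.
Qed.

Lemma markov_chain_L2 i n f g : (i <= n)%N -> f \in L2 -> g \in L2 ->
  ipP (g \o X i) (f \o X n.+1) = ipP (g \o X i) (kernel_op Q f \o X n).
Proof.
move=> iln L2f L2g.
have pf := nnegL2_funrpos L2f; have nf := nnegL2_funrneg L2f.
have pg := nnegL2_funrpos L2g; have ng := nnegL2_funrneg L2g.
have [L2p _] := kernel_pos_L2 revQ pf; have [L2n _] := kernel_pos_L2 revQ nf.
have L2g' := Lfun2_chain i L2g.
have L2pg := Lfun2_chain i pg.1; have L2ng := Lfun2_chain i ng.1.
have split_ u : u \in Lfun P 2%:E ->
    ipP (g \o X i) u = (ipP (g^\+ \o X i) u - ipP (g^\- \o X i) u)%R.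
  move=> L2u; rewrite -inner_prodBl//; congr (inner_prod P _ u).
  by apply/funext => w; rewrite /= -{1}[g]funrposBneg.
have -> : f \o X n.+1 = (fun w => (f^\+ \o X n.+1) w - (f^\- \o X n.+1) w)%R.
  by apply/funext => w; rewrite /= -{1}[f]funrposBneg.
have -> : kernel_op Q f \o X n =
  (fun w => (kernel_pos Q f^\+ \o X n) w - (kernel_pos Q f^\- \o X n) w)%R by [].
rewrite !inner_prodBr ?Lfun2_chain//; try by [exact: pf.1|exact: nf.1].
rewrite !split_ ?Lfun2_chain//; try by [exact: pf.1|exact: nf.1].
by rewrite !markov_pos.
Qed.

(** Conditioning removes the last transition and replaces [f] by its image under the kernel, so the
    induction ranges over [f]. *)
Lemma autocovariance_chain i k f g : f \in L2 -> g \in L2 ->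
  ipP (g \o X i) (f \o X (i + k)%N) = ip g (iter k (kernel_op Q) f).
Proof.
move=> + L2g; elim: k f => [|k IH] f L2f; first by rewrite addn0 inner_prod_chain.
rewrite addnS markov_chain_L2 ?leq_addr// IH ?kernel_op_L2//.
by rewrite iterSr.
Qed.

Variable h : T -> R.
Hypothesis h0 : L2_0 mu h.

Let L2h : h \in L2. Proof. by case: h0. Qed.

Let c k := ip h (iter k (kernel_op Q) h).

Let s m := (c 0 + 2 * \sum_(k < m) c k.+1)%R.

Let S n w := (\sum_(i < n) h (X i w))%R.

Let L2S n : S n \in Lfun P 2%:E.
Proof.
elim: n => [|n IH].
  have -> : S 0 = cst 0%R by apply/funext => w; rewrite /S big_ord0.
  exact: Lfun_cst.
have -> : S n.+1 = (S n + (h \o X n))%R.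
  by apply/funext => w; rewrite /S big_ord_recr.
have L2hn := Lfun2_chain n L2h.
by rewrite rpredD ?lee1n.
Qed.

Let SE n u : u \in Lfun P 2%:E -> ipP (S n) u = (\sum_(i < n) ipP (h \o X i) u)%R.
Proof.
move=> L2u; elim: n => [|n IH].
  rewrite big_ord0 /S unlock; under eq_Rintegral do rewrite big_ord0 mul0r.
  by rewrite Rintegral_cst// mul0r.
rewrite big_ord_recr /= -IH -[X in (X + _)%R]mul1r.
rewrite -inner_prod_linearl ?Lfun2_chain//; congr (inner_prod P _ u).
by apply/funext => w; rewrite /S big_ord_recr /= mul1r.
Qed.

(** Adding [h (X n)] increases the second moment by [c_0 + 2 <S n, h (X n)>], which is [s n] once
    the lags are counted backwards from [n]. *)
Let S2 n : ipP (S n) (S n) = series s n.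
Proof.
elim: n => [|n IH]; first by rewrite SE// big_ord0 /series /= big_geq.
rewrite seriesSr -IH.
have SS w : S n.+1 w = (1 * S n w + (h \o X n) w)%R.
  by rewrite /S big_ord_recr /= mul1r.
have L2hn := Lfun2_chain n L2h.
rewrite (_ : S n.+1 = fun w => (1 * S n w + (h \o X n) w)%R); last exact/funext.
have L2S' : (fun w => (1 * S n w + (h \o X n) w)%R) \in Lfun P 2%:E.
  by rewrite (_ : (fun w => _) = S n.+1)//; exact/esym/funext.
rewrite inner_prod_linearl// (inner_prodC _ (S n)) (inner_prodC _ (h \o X n)).
rewrite !inner_prod_linearl// (inner_prodC _ (h \o X n) (S n)) inner_prod_chain//.
have -> : ipP (S n) (h \o X n) = (\sum_(k < n) c k.+1)%R.
  rewrite SE// (reindex_inj rev_ord_inj)/=; apply: eq_bigr => k _.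
  have := autocovariance_chain (n - k.+1) k.+1 L2h L2h.
  by rewrite subnK.
rewrite /s /c/=; ring.
Qed.

(** Centring turns the variance into a second moment. The shift appears because
    [arithmetic_mean s n] averages [n + 1] terms. *)
Lemma scaled_mean_variance_chain n :
  scaled_mean_variance X h n.+1 = (arithmetic_mean s n)%:E.
Proof.
rewrite /scaled_mean_variance.
have -> : (fun w => n.+1%:R^-1 * \sum_(i < n.+1) h (X i w))%R =
    (n.+1%:R^-1 \o* S n.+1)%R by apply/funext => w /=; rewrite mulrC.
rewrite varianceZ// varianceE//.
have -> : 'E_P[S n.+1] = 0.
  have L21 : cst 1%R \in Lfun P 2%:E by exact: Lfun_cst.
  have L21' : cst 1%R \in L2 by exact: Lfun_cst.
  transitivity (ipP (S n.+1) (cst 1%R))%:E.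
    by rewrite inner_prodE// unlock; apply: eq_integral => w _; rewrite mulr1.
  rewrite SE// big1// => i _.
  have -> : cst 1%R = cst 1%R \o X i by [].
  rewrite inner_prod_chain//; apply: EFin_inj.
  rewrite inner_prodE//; case: h0 => _; rewrite unlock => Eh.
  by rewrite -[RHS]Eh; apply: eq_integral => x _; rewrite mulr1.
have -> : 'E_P[S n.+1 ^+ 2] = (series s n.+1)%:E.
  by rewrite -S2 inner_prodE// unlock.
rewrite expe2 mul0e sube0 -!EFinM; congr EFin; rewrite /arithmetic_mean /= expr2.
by rewrite !mulrA divff ?mul1r// pnatr_eq0.
Qed.

End reversible_chain.

(** * The left spectral gap as a bound on the quadratic form *)

Section gap.
Context d (T : measurableType d) (R : realType).
Variables (mu : probability T R) (Q : R.-pker T ~> T).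
Hypothesis revQ : reversible mu Q.
Variable eps : R.
Hypothesis gapE : left_spectral_gap mu Q = eps%:E.
Local Notation L2 := (Lfun mu 2%:E).
Local Notation ip := (inner_prod mu).
Implicit Types f g : T -> R.

Let infE : ereal_inf [set \int[mu]_x \int[Q x]_y (f x * f y)%:E |
    f in [set f | L2_0 mu f /\ 'N[mu]_2%:E[EFin \o f] = 1]] = (eps - 1)%:E.
Proof.
move: gapE; rewrite /left_spectral_gap; case: ereal_inf => [r| |]//= [<-].
by congr EFin; ring.
Qed.

Lemma L2_0_kernel_op f : L2_0 mu f -> L2_0 mu (kernel_op Q f).
Proof.
move=> [L2f f0]; split; first exact: kernel_op_L2.
by move: f0; rewrite unlock => <-; exact: kernel_op_mean.
Qed.

Lemma inner_kernel_opZ (k : R) f : f \in L2 ->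
  ip (fun x => k * f x)%R (kernel_op Q (fun x => k * f x)%R) =
  (k * k * ip f (kernel_op Q f))%R.
Proof.
move=> L2f; have L2g := Lfun2Z k L2f.
rewrite inner_prodZl ?kernel_op_L2// (kernel_op_sym revQ L2g L2f).
by rewrite inner_prodZl ?kernel_op_L2// mulrA.
Qed.

(** The infimum runs over unit vectors, so [f] is normalized; if its norm is zero, the bound
    [-1 <= Q] suffices. *)
Lemma left_gap_bound f : L2_0 mu f ->
  ((eps - 1) * ip f f <= ip f (kernel_op Q f))%R.
Proof.
move=> [L2f f0].
have [ff0|ff0] := eqVneq (ip f f) 0%R.
  by have := kernel_op_geN revQ L2f; rewrite ff0 mulr0 oppr0.
have ffge0 : (0 <= ip f f)%R by apply: inner_prod_ge0 => x; rewrite -expr2 sqr_ge0.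
have ffgt0 : (0 < ip f f)%R by rewrite lt_neqAle eq_sym ff0.
pose k := (Num.sqrt (ip f f))^-1%R.
have k2 : (k * k * ip f f = 1)%R.
  by rewrite /k -invfM -expr2 sqr_sqrtr// mulVf.
have k0 : (0 < k * k)%R by have := k2; nra.
pose g x := (k * f x)%R.
have L2g : g \in L2 by exact: Lfun2Z.
have gg : ip g g = 1%R by rewrite /g inner_prodZl// inner_prodC inner_prodZl// mulrA.
have gQg : ip g (kernel_op Q g) = (k * k * ip f (kernel_op Q f))%R.
  exact: inner_kernel_opZ.
have N1 : 'N[mu]_2%:E[EFin \o g] = 1.
  have := Lnorm2_sqr L2g; rewrite gg.
  have := Lnorm_ge0 mu 2%:E (EFin \o g).
  case: ('N[mu]_2%:E[EFin \o g]) => [r| |]//; rewrite lee_fin => r0.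
  by rewrite expe2 => -[/eqP]; rewrite -expr2 sqrp_eq1// => /eqP ->.
have g0 : L2_0 mu g.
  split=> //; move: f0; rewrite unlock => f0.
  under eq_integral do rewrite EFinM.
  rewrite integralZl//; first by rewrite f0 mule0.
  by apply/Lfun1_integrable; rewrite Lfun_subset12// fin_num_measure.
have : ereal_inf [set \int[mu]_x \int[Q x]_y (f x * f y)%:E |
    f in [set f | L2_0 mu f /\ 'N[mu]_2%:E[EFin \o f] = 1]] <=
    \int[mu]_x \int[Q x]_y (g x * g y)%:E.
  by apply: ereal_inf_lbound; exists g.
rewrite infE (kernel_op_quadratic revQ L2g) gQg lee_fin => H.
rewrite -(ler_pM2l k0); apply: le_trans H.
by rewrite mulrCA k2 mulr1.
Qed.

End gap.

Section reversible_chain_variance.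
Context d (T : measurableType d) (R : realType).
Variables (mu : probability T R) (Q : R.-pker T ~> T).
Hypothesis revQ : reversible mu Q.
Variable eps : R.
Hypothesis eps_gt0 : (0 < eps)%R.
Hypothesis gapE : left_spectral_gap mu Q = eps%:E.
Context dO (Omega : measurableType dO).
Variables (P : probability Omega R) (X : nat -> {RV P >-> T}).
Hypothesis chainX : markov_chain mu Q X.
Variable h : T -> R.
Hypothesis h0 : L2_0 mu h.
Local Notation L2 := (Lfun mu 2%:E).
Local Notation ip := (inner_prod mu).
Local Notation V := (LfunType mu (lee1n 2)).

Let ipV (u v : V) : R := ip u v.

Let QV (u : V) : V := Lfun_Sub (lee1n 2) (kernel_op_L2 revQ (LfunP u)).

Let hV : V := Lfun_Sub (lee1n 2) h0.1.

Let iter_QV k : (iter k QV hV : T -> R) = iter k (kernel_op Q) h.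
Proof. by elim: k => //= k <-. Qed.

Let L2_0_iter k : L2_0 mu (iter k (kernel_op Q) h).
Proof. by elim: k => //= k; exact: L2_0_kernel_op. Qed.

Theorem reversible_chain_variance :
  scaled_mean_variance X h @ \oo --> +oo \/
  exists l : R, scaled_mean_variance X h @ \oo --> l%:E /\
    forall f, f \in L2 ->
      (2 * (2 * ip h f - (ip f f - ip f (kernel_op Q f))) - ip h h <= l)%R.
Proof.
have smvE : (fun n => scaled_mean_variance X h n.+1) =
    EFin \o arithmetic_mean (autocov_sum ipV QV hV).
  apply/funext => n; rewrite (scaled_mean_variance_chain revQ chainX h0) /=.
  congr (arithmetic_mean _ n)%:E; apply/funext => m.
  rewrite /autocov_sum /autocov /ipV/=; congr (_ + 2 * _)%R.
  by apply: eq_bigr => k _; rewrite -iterS iter_QV.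
have [|||||||cvgs|[l [cvgs lb]]] :=
  @autocov_sum_cvg R V ipV QV _ _ _ _ _ _ hV eps eps_gt0.
- by move=> u v; exact: inner_prodC.
- move=> a u v w; rewrite /ipV -inner_prod_linearl//; exact: LfunP.
- by move=> u; apply: inner_prod_ge0 => x; rewrite -expr2 sqr_ge0.
- by move=> u v; apply: kernel_op_sym => //; exact: LfunP.
- by move=> u; apply: kernel_op_le => //; exact: LfunP.
- by move=> u; apply: kernel_op_geN => //; exact: LfunP.
- move=> k /=; rewrite /ipV /= iter_QV.
  exact: (left_gap_bound revQ gapE (L2_0_iter k)).
- left; rewrite -cvg_shiftS smvE; apply/cvgeryP.
  exact: cesaro_pinfty.
- right; exists l; split.
    rewrite -cvg_shiftS smvE; apply: cvg_EFin; first exact: nearW.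
    exact: cesaro.
  move=> f L2f; have := lb (Lfun_Sub (lee1n 2) L2f).
  by rewrite /dirichlet /autocov /ipV.
Qed.

End reversible_chain_variance.

(** * Variational lower bounds *)

Section rejection_bound.
Context d (T : measurableType d) (R : realType).
Variables (mu : probability T R) (Q : R.-pker T ~> T).
Variable K : T -> {measure set T -> \bar R}.
Hypothesis mK : forall U, measurable U -> measurable_fun setT (K ^~ U).
Hypothesis revK : reversible mu K.
Variable a : T -> R.
Hypothesis KT : forall x, K x setT = (a x)%:E.
Hypothesis a_le1 : forall x, (a x <= 1)%R.
Hypothesis QE : forall x A, measurable A ->
  Q x A = K x A + (1 - a x)%:E * \d_x A.
Local Notation L2 := (Lfun mu 2%:E).
Local Notation ip := (inner_prod mu).
Variables (h : T -> R) (l : R).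
Hypothesis L2h : h \in L2.
Hypothesis variational : forall f, f \in L2 ->
  (2 * (2 * ip h f - (ip f f - ip f (kernel_op Q f))) - ip h h <= l)%R.

Let a_ge0 x : (0 <= a x)%R.
Proof. by rewrite -lee_fin -KT measure_ge0. Qed.

Let ma : measurable_fun setT a.
Proof.
apply/measurable_EFinP; rewrite (_ : EFin \o a = K ^~ setT); first exact: mK.
by apply/funext => x /=; rewrite KT.
Qed.

(* The variational bound at the test function [phi * h / 2]. *)
Let bounded_weight (phi : T -> R) (N : R) : measurable_fun setT phi ->
  (forall x, 0 <= phi x <= N)%R -> (forall x, a x * phi x <= 1)%R ->
  \int[mu]_x (h x ^+ 2 * phi x)%:E <= (l + ip h h)%:E.
Proof.
move=> mphi phiN aphi.
have mh := Lfun2_measurable L2h.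
have phi0 x : (0 <= phi x)%R by case/andP: (phiN x).
have N0 : (0 <= N)%R by case/andP: (phiN point) => /le_trans; apply.
have L2Nh := Lfun2Z N L2h.
(* At [f = s phi h] the gain is at least [(2 s - 2 s^2) <h, phi h>], maximal at [s = 1/2]. *)
pose f x := (2^-1 * (phi x * h x))%R.
have L2ph : (fun x => phi x * h x)%R \in L2.
  apply: (Lfun2_le _ L2Nh); first exact: measurable_funM.
  move=> x; rewrite !normrM ler_wpM2r// (ger0_norm N0) ger0_norm//.
  by case/andP: (phiN x).
have L2f : f \in L2 by exact: Lfun2Z.
have L2af : (fun x => a x * f x)%R \in L2.
  by apply: Lfun2_mul01 => // x; rewrite a_ge0 a_le1.
have hf : ip h f = (2^-1 * ip h (fun x => phi x * h x))%R.
  by rewrite inner_prodC /f inner_prodZl// inner_prodC.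
have faf : (4 * ip f (fun x => a x * f x) <= ip h (fun x => phi x * h x))%R.
  have -> : (4 * ip f (fun x => a x * f x) =
      ip (fun x => 4 * f x) (fun x => a x * f x))%R.
    by rewrite (inner_prodZl 4%R L2f L2af).
  have L24f := Lfun2Z 4%R L2f.
  rewrite -lee_fin !inner_prodE//.
  have E x : (4 * f x * (a x * f x) = (a x * phi x) * (h x * (phi x * h x)))%R.
    by rewrite /f; field.
  have hph x : (0 <= h x * (phi x * h x))%R.
    by rewrite mulrCA mulr_ge0// -expr2 sqr_ge0.
  apply: ge0_le_integral => //.
  - by move=> x _; rewrite lee_fin E mulr_ge0// mulr_ge0.
  - apply/measurable_EFinP; apply: measurable_funM.
      exact: (Lfun2_measurable L24f).
    exact: (Lfun2_measurable L2af).
  - apply/measurable_EFinP; apply: measurable_funM => //; exact: (Lfun2_measurable L2ph).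
  - by move=> x _; rewrite lee_fin E ler_piMl.
have -> : \int[mu]_x (h x ^+ 2 * phi x)%:E = (ip h (fun x => phi x * h x)%R)%:E.
  rewrite inner_prodE//; apply: eq_integral => x _; congr EFin; ring.
rewrite lee_fin.
have := variational L2f; have := kernel_op_ge mK revK KT a_le1 QE L2f.
rewrite hf; lra.
Qed.

(** [y h] need not lie in L2, and [y] may be infinite. Truncating [y] at [n] preserves the bound on
    [a y]; monotone convergence removes the truncation. *)
Lemma weighted_sqr_le (y : T -> \bar R) : ge0_mfun y ->
  (forall x, (a x)%:E * y x <= 1) ->
  \int[mu]_x ((h x ^+ 2)%:E * y x) <= (l + ip h h)%:E.
Proof.
move=> [my y0] ay; have mh := Lfun2_measurable L2h.
pose yn n x := mine (y x) n%:R%:E.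
have yn0 n x : 0 <= yn n x by rewrite le_min y0 lee_fin/=.
have ynfin n x : yn n x \is a fin_num.
  by rewrite ge0_fin_numE// gt_min ltry orbT.
have myn n : measurable_fun setT (yn n) by exact: measurable_mine.
have ynE n x : (h x ^+ 2)%:E * yn n x = (h x ^+ 2 * fine (yn n x))%:E.
  by rewrite [RHS]EFinM fineK.
have mh2 : measurable_fun setT (fun x => (h x ^+ 2)%:E).
  by apply/measurable_EFinP; exact: measurable_funX.
have cvgy x : yn n x @[n --> \oo] --> y x.
  rewrite /yn; have := y0 x; case: (y x) => [r r0| _|//].
    apply: cvg_near_cst; near=> n; rewrite min_l// lee_fin.
    by near: n; exact: nbhs_infty_ger.
  under eq_fun do rewrite min_r ?leey//.
  by apply/cvgeryP; exact: cvgr_idn.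
have -> : \int[mu]_x ((h x ^+ 2)%:E * y x) =
    \int[mu]_x limn (fun n => (h x ^+ 2)%:E * yn n x).
  by apply: eq_integral => x _; apply/esym/cvg_lim => //; exact: cvgeZl.
have mhyn n : measurable_fun setT (fun x => (h x ^+ 2)%:E * yn n x).
  exact: emeasurable_funM.
have hyn0 n x : 0 <= (h x ^+ 2)%:E * yn n x.
  by rewrite mule_ge0// lee_fin sqr_ge0.
have hynd x : nondecreasing_seq (fun n => (h x ^+ 2)%:E * yn n x).
  move=> n m nm; rewrite lee_wpmul2l ?lee_fin ?sqr_ge0//.
  by rewrite /yn le_min ge_min lexx/= ge_min lee_fin ler_nat nm orbT.
rewrite monotone_convergence//.
apply: lime_le.
  apply: ereal_nondecreasing_is_cvgn => n m nm; apply: ge0_le_integral => //.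
  by move=> x _; exact: hynd.
apply: nearW => n; under eq_integral do rewrite ynE.
apply: (@bounded_weight _ n%:R).
- exact: (measurableT_comp (fine_measurable measurableT)).
- move=> x; rewrite fine_ge0//= -lee_fin fineK//.
  by rewrite ge_min lexx orbT.
- move=> x; rewrite -lee_fin EFinM fineK//; apply: le_trans (ay x).
  by rewrite lee_wpmul2l ?lee_fin// ge_min lexx.
Unshelve. all: by end_near. Qed.

End rejection_bound.

Lemma measurable_fun_inve d (T : measurableType d) (R : realType)
    (D : set T) (f : T -> \bar R) :
  measurable_fun D f -> measurable_fun D (fun x => (f x)^-1).
Proof.
move=> mf.
have m1 : measurable_fun setT (fun x : \bar R => (fine x)^-1%:E).
  apply/measurable_EFinP; apply: measurable_fun_invr; exact: fine_measurable.
have m0 : measurable_fun setT (fun x : \bar R => x^-1).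
  (* The inverse sends 0 to [+oo] and fixes [-oo]; at [+oo] the last branch gives 0, since [fine]
     and the real inverse both return 0. *)
  rewrite (_ : (fun x => x^-1) = (fun x : \bar R => if x == 0 then +oo else
     if x == -oo then -oo else (fine x)^-1%:E)); last first.
    by apply/funext => -[r| |]; rewrite ?inver ?eqe //= invr0.
  apply: measurable_fun_ifT => //.
    by apply: measurable_fun_eqe.
  apply: measurable_fun_ifT => //.
  by apply: measurable_fun_eqe.
exact: (measurableT_comp m0 mf).
Qed.

Section gap_bound.
Context d (T : measurableType d) (R : realType).
Variables (mu : probability T R) (Q : R.-pker T ~> T).
Hypothesis revQ : reversible mu Q.
Variable eps : R.
Hypothesis eps_gt0 : (0 < eps)%R.
Hypothesis gapE : left_spectral_gap mu Q = eps%:E.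
Local Notation L2 := (Lfun mu 2%:E).
Local Notation ip := (inner_prod mu).
Variables (h : T -> R) (l : R).
Hypothesis h0 : L2_0 mu h.
Hypothesis variational : forall f, f \in L2 ->
  (2 * (2 * ip h f - (ip f f - ip f (kernel_op Q f))) - ip h h <= l)%R.

Let scaled_bound (t : R) :
  (2 * (2 * t * ip h h - t * t * ((2 - eps) * ip h h)) - ip h h <= l)%R.
Proof.
have L2h := h0.1; apply: le_trans (variational (Lfun2Z t L2h)).
have := left_gap_bound revQ gapE h0.
rewrite (inner_kernel_opZ revQ)//.
rewrite (inner_prodZl t L2h (Lfun2Z t L2h)).
rewrite (inner_prodC mu h (fun x => t * h x)%R) inner_prodZl//.
have : (0 <= t * t)%R by rewrite -expr2 sqr_ge0.
nra.
Qed.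

Lemma variational_gap_bound (I : \bar R) : I <= (l + ip h h)%:E ->
  ((- eps^-1)%:E + eps%:E / (4 - 2 * eps)%:E) * (ip h h)%:E + 2^-1%:E * I
  <= l%:E.
Proof.
move=> Il; have n0 : (0 <= ip h h)%R.
  by apply: inner_prod_ge0 => x; rewrite -expr2 sqr_ge0.
have I2 : 2^-1%:E * I <= (2^-1 * (l + ip h h))%:E.
  by rewrite EFinM lee_wpmul2l.
have [n_eq0|n_neq0] := eqVneq (ip h h) 0%R.
  rewrite n_eq0 mule0 add0e; apply: le_trans I2 _; rewrite lee_fin n_eq0.
  by have := scaled_bound 0; rewrite n_eq0; lra.
have n_gt0 : (0 < ip h h)%R by rewrite lt_neqAle eq_sym n_neq0.
(* For [eps >= 2] the lower bound would grow at least linearly in [t], contradicting the finite [l].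
   Strictness matters: at [eps = 2] the coefficient would be infinite. *)
have eps2 : (eps < 2)%R.
  rewrite ltNge; apply/negP => eps_ge2.
  pose t := ((`|l| + ip h h) / ip h h)%R.
  have tn : (t * ip h h = `|l| + ip h h)%R by rewrite /t divfK.
  have := scaled_bound t; have := ler_norm l.
  have : (t * t * ((2 - eps) * ip h h) <= 0)%R.
    by rewrite mulr_ge0_le0// -?expr2 ?sqr_ge0// mulr_le0_ge0//; lra.
  rewrite -[(2 * t * _)%R]mulrA tn; have := normr_ge0 l; lra.
have e0 : (0 < 4 - 2 * eps)%R by lra.
rewrite inver gt_eqF//= -EFinM.
apply: le_trans (leeD (le_refl _) I2) _; rewrite -EFinD lee_fin.
(* The maximizer of the quadratic in [t]. *)
have := scaled_bound (2 - eps)^-1.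
have -> : (2 * (2 * (2 - eps)^-1 * ip h h - (2 - eps)^-1 * (2 - eps)^-1 *
    ((2 - eps) * ip h h)) - ip h h = 2 * (eps / (4 - 2 * eps)) * ip h h)%R.
  by field; rewrite !gt_eqF//= subr_gt0.
(* Averaging produces the constant [-1/2], here weakened to [-1/eps]. *)
have : (2^-1 * ip h h <= eps^-1 * ip h h)%R.
  by rewrite ler_wpM2r// lef_pV2 ?posrE// ltW.
lra.
Qed.

End gap_bound.

(** * The pseudo-marginal kernel *)

Section pseudo_marginal.
Context (R : realType) (d : nat) (M : pm_model R d).
Local Notation T := (pm_state R d).
Local Notation leb := (pm_leb R d).
Local Notation K := (fun x => pm_move M x : {measure set T -> \bar R}).

Definition pm_acc x : R := fine (pm_move M x setT).

Lemma pm_move_setT x : pm_move M x setT = (pm_acc x)%:E.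
Proof.
rewrite /pm_acc fineK// ge0_fin_numE; last exact: (measure_ge0 (K x)).
exact: le_lt_trans (pm_move_setT_le1 M x) (ltry _).
Qed.

Lemma pm_acc_le1 x : (pm_acc x <= 1)%R.
Proof. by rewrite -lee_fin -pm_move_setT pm_move_setT_le1. Qed.

Lemma pm_kernelE x A : measurable A ->
  pm_kernel M x A = K x A + (1 - pm_acc x)%:E * \d_x A.
Proof. by move=> mA; rewrite /pm_kernel /= /pm_trans pm_move_setT. Qed.

Let mm x : measurable_fun setT (fun z => pm_move_density M (x, z)).
Proof.
exact: (measurableT_comp (measurable_pm_move_density M) (measurable_pair1 x)).
Qed.

Lemma ge0_integral_pm_move x (f : T -> \bar R) : ge0_mfun f ->
  \int[K x]_z f z = \int[leb]_z ((pm_move_density M (x, z))%:E * f z).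
Proof.
apply: (@ge0_integral_density _ _ _ leb (K x)
  (fun z => pm_move_density M (x, z))) => //.
by move=> z; exact: pm_move_density_ge0.
Qed.

Lemma ge0_integral_pm_stationary (f : T -> \bar R) : ge0_mfun f ->
  \int[pm_stationary M]_x f x = \int[leb]_x ((pm_density M x)%:E * f x).
Proof.
apply: (@ge0_integral_density _ _ _ leb (pm_stationary M) (pm_density M)) => //.
- exact: measurable_pm_density.
- exact: pm_density_ge0.
Qed.

Lemma measurable_pm_move A : measurable A ->
  measurable_fun setT (fun x => K x A).
Proof.
move=> mA.
have -> : (fun x => K x A) = (fun x =>
    \int[leb]_z (pm_move_density M (x, z) * \1_A z)%:E)%E.
  apply/funext => x; rewrite /= /pm_move integral_mkcond.
  apply: eq_integral => z _; rewrite patchE indicE.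
  by case: ifPn => _; rewrite ?mulr1 ?mulr0.
apply: (measurable_fun_fubini_tonelli_F (m2 := leb)
    (fun p : T * T => (pm_move_density M p * \1_A p.2)%:E)).
  apply/measurable_EFinP; apply: measurable_funM.
    exact: measurable_pm_move_density.
  exact: (measurableT_comp (measurable_indic mA) measurable_snd).
by move=> p; rewrite lee_fin mulr_ge0 ?pm_move_density_ge0 ?indicE.
Qed.

(** Puts acceptance into symmetric form. At [A = 0] both sides vanish, whatever value the division
    takes. *)
Let min_mulr (A B : R) : (0 <= A)%R -> (0 <= B)%R ->
  (A * Num.min 1 (B / A) = Num.min A B)%R.
Proof.
move=> A0 B0; have [->|An0] := eqVneq A 0%R; first by rewrite mul0r min_l.
by rewrite minr_pMr// mulr1 mulrC divfK.
Qed.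

Lemma pm_detailed_balance x z :
  (pm_density M x * pm_move_density M (x, z) =
   pm_density M z * pm_move_density M (z, x))%R.
Proof.
have [xS|xS] := pselect (pm_space M x); last first.
  rewrite /pm_density /pm_move_density !patchE.
  rewrite (memNset xS) (memNset (_ : ~ (_ `*` _) (z, x))); last by case.
  by rewrite mul0r mulr0.
have [zS|zS] := pselect (pm_space M z); last first.
  rewrite /pm_density /pm_move_density !patchE.
  rewrite (memNset zS) (memNset (_ : ~ (_ `*` _) (x, z))); last by case.
  by rewrite mul0r mulr0.
(* The right side is symmetric in [u] and [v]. *)
suff balance u v : pm_space M u -> pm_space M v ->
  (pm_density M u * pm_move_density M (u, v) =
  pm_qw M u.1 u.2 * pm_qw M v.1 v.2 *
  Num.min (pm_pi M u.1 * u.2 * pm_q M u.1 v.1)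
          (pm_pi M v.1 * v.2 * pm_q M v.1 u.1))%R.
  rewrite !balance//; rewrite minC; congr (_ * _)%R; exact: mulrC.
move=> uS vS; rewrite /pm_density /pm_move_density !patchE.
rewrite mem_set// mem_set//=.
have [u1 u2] := uS; have [v1 v2] := vS.
rewrite -min_mulr; last 2 first.
- by rewrite !mulr_ge0 ?(pm_pi_ge0 u1) ?(pm_W_ge0 u2) ?(pm_q_ge0 u1 v1).
- by rewrite !mulr_ge0 ?(pm_pi_ge0 v1) ?(pm_W_ge0 v2) ?(pm_q_ge0 v1 u1).
rewrite /pm_accept /mh_ratio /pm_nu.
set A := (pm_pi M u.1 * u.2 * pm_q M u.1 v.1)%R.
rewrite (_ : (pm_pi M v.1 * pm_q M v.1 u.1 / (pm_pi M u.1 * pm_q M u.1 v.1) *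
  v.2 / u.2 = pm_pi M v.1 * v.2 * pm_q M v.1 u.1 / A)%R).
  by rewrite /A; ring.
by rewrite /A !invfM; ring.
Qed.

Lemma reversible_pm_move : reversible (pm_stationary M) K.
Proof.
move=> f g gf gg.
have expand u v : ge0_mfun u -> ge0_mfun v ->
    \int[pm_stationary M]_x (v x * \int[K x]_z u z) =
    \int[leb]_x \int[leb]_z
      ((pm_density M x * pm_move_density M (x, z))%:E * (v x * u z)).
  move=> gu gv; have [mu u0] := gu; have [mv v0] := gv.
  have Ku0 x : 0 <= \int[K x]_z u z by exact: integral_ge0.
  have mKu : measurable_fun setT (fun x => \int[K x]_z u z).
    by apply: measurable_fun_integral_kernel => //; exact: measurable_pm_move.
  rewrite ge0_integral_pm_stationary; last first.
    by split=> [|x]; [exact: emeasurable_funM|exact: mule_ge0].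
  apply: eq_integral => x _; rewrite ge0_integral_pm_move//.
  rewrite muleA -ge0_integralZl//; last 3 first.
  - by apply: emeasurable_funM => //; apply/measurable_EFinP; exact: mm.
  - by move=> z _; rewrite mule_ge0// lee_fin pm_move_density_ge0.
  - by rewrite mule_ge0// lee_fin pm_density_ge0.
  by apply: eq_integral => z _; rewrite EFinM !muleA (muleAC _ (v x)).
rewrite (expand f g gf gg) (expand g f gg gf).
pose F (p : T * T) := (pm_density M p.1 * pm_move_density M p)%:E * (g p.1 * f p.2).
have [mf f0] := gf; have [mg g0] := gg.
have mF : measurable_fun setT F.
  apply: emeasurable_funM.
    apply/measurable_EFinP; apply: measurable_funM.
      exact: (measurableT_comp (measurable_pm_density M) measurable_fst).
    exact: measurable_pm_move_density.
  by apply: emeasurable_funM; exact: measurableT_comp.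
have F0 p : 0 <= F p.
  by rewrite mule_ge0// ?mule_ge0// lee_fin mulr_ge0// ?pm_density_ge0 ?pm_move_density_ge0.
have := @fubini_tonelli _ _ _ _ _ leb leb F mF F0; rewrite /F /= => ->.
apply: eq_integral => z _; apply: eq_integral => x _.
by rewrite pm_detailed_balance (muleC (g x)).
Qed.

(** Bound the minimum by its second argument: the current weight cancels, and the proposed weight
    integrates to 1. *)
Lemma pm_acc_mean_ratio x : pm_space M x ->
  (x.2 : R)%:E * (pm_acc x)%:E <= mean_ratio M x.1.
Proof.
move=> xS; have [Xx Wx] := xS; have w0 := pm_W_ge0 Wx.
rewrite -pm_move_setT /pm_move -ge0_integralZl_EFin//; last 2 first.
- by move=> z _; rewrite lee_fin pm_move_density_ge0.
- by apply/measurable_EFinP; exact: mm.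
rewrite pm_leb_tonelli; last 2 first.
- by apply: measurable_funeM; apply/measurable_EFinP; exact: mm.
- by move=> z; rewrite mule_ge0// lee_fin pm_move_density_ge0.
have [mX mW] := (pm_mX M, pm_mW M).
have mxm : measurable_fun setT (fun z => (x.2 : R)%:E * (pm_move_density M (x, z))%:E).
  by apply: measurable_funeM; apply/measurable_EFinP; exact: mm.
rewrite /mean_ratio [leRHS]integral_mkcond; apply: ge0_le_integral => //.
- move=> t _; apply: integral_ge0 => w _.
  by rewrite mule_ge0// lee_fin pm_move_density_ge0.
- apply: (measurable_fun_fubini_tonelli_F (m2 := @lebesgue_measure R)
    (fun z : T => (x.2 : R)%:E * (pm_move_density M (x, z))%:E)) => // z.
  by rewrite mule_ge0// lee_fin pm_move_density_ge0.
- apply/(measurable_restrictT _ mX); apply/measurable_EFinP.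
  apply: measurable_funM; first exact: measurable_pm_q.
  apply: measurable_funM; last first.
    by apply: measurable_fun_invr; apply: measurable_funM => //; exact: measurable_pm_q.
  apply: measurable_funM; first exact: pm_mpi.
  apply: (measurable_comp (measurableX mX mX) _ (pm_mq M) (g := fun t => (t, x.1))).
    by move=> _ [t Xt <-].
  by apply: measurable_funTS; exact: measurable_pair2.
move=> t _; rewrite patchE; case: ifPn => [/[!inE] Xt|Xt]; last first.
  rewrite integral0_eq// => w _; rewrite /pm_move_density patchE memNset ?mule0//.
  by move=> [_ [/= Xt' _]]; move: Xt; rewrite notin_setE; apply.
have qr0 : (0 <= pm_q M x.1 t * mh_ratio M x.1 t)%R.
  by rewrite mulr_ge0 ?pm_q_ge0 ?mh_ratio_ge0.
have mwq : measurable_fun (pm_W M) (fun w => ((w : R) * pm_qw M t w)%:E).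
  apply/measurable_EFinP.
  apply: (measurable_funM (f := id : measurableTypeR R -> R)).
    by apply: measurable_funTS; exact: measurable_id.
  exact: measurable_pm_qw.
rewrite -[leRHS]mule1 -(pm_qw_mean1 Xt) -ge0_integralZl//; last first.
  by move=> w Ww; rewrite lee_fin mulr_ge0 ?(pm_W_ge0 Ww)// (pm_qw_ge0 Xt Ww).
rewrite [leRHS]integral_mkcond; apply: ge0_le_integral => //.
- by move=> w _; rewrite mule_ge0// lee_fin pm_move_density_ge0.
- exact: (measurableT_comp mxm (measurable_pair1 t)).
- apply/(measurable_restrictT _ mW); exact: measurable_funeM.
move=> w _; rewrite /pm_move_density !patchE.
case: ifPn => [/[!inE] -[/= _ [/= _ Ww]]|_]; last first.
  rewrite mule0; case: ifPn => // /[!inE] Ww.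
  by rewrite mule_ge0 ?lee_fin// mulr_ge0 ?(pm_W_ge0 Ww)// (pm_qw_ge0 Xt Ww).
rewrite mem_set// -!EFinM lee_fin /pm_accept /=.
have [[q0 qw0] r0] := (pm_q_ge0 Xx Xt, pm_qw_ge0 Xt Ww, mh_ratio_ge0 Xx Xt).
(* A zero weight cannot be cancelled, but then the left side is 0. *)
have [->|x20] := eqVneq x.2 0%R.
  by rewrite mul0r; apply: mulr_ge0 => //; apply: mulr_ge0 => //; exact: pm_W_ge0 Ww.
rewrite (_ : (_ * mh_ratio M x.1 t * _)%R = (x.2 *
  (pm_q M x.1 t * pm_qw M t w * (mh_ratio M x.1 t * w / x.2)))%R); last by field.
by rewrite ler_wpM2l// ler_wpM2l ?mulr_ge0// ge_min lexx orbT.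
Qed.

(** At [r = +oo] the quotient is 0. At [r = 0] the product of acceptance and weight is 0, and it
    annihilates the infinite inverse. *)
Lemma pm_acc_div_mean_ratio x : pm_space M x ->
  (pm_acc x)%:E * ((x.2 : R)%:E / mean_ratio M x.1) <= 1.
Proof.
move=> xS; have := pm_acc_mean_ratio xS.
have : (0 <= pm_acc x * x.2)%R.
  by rewrite mulr_ge0 ?(pm_W_ge0 xS.2)// -lee_fin -pm_move_setT (measure_ge0 (K x)).
rewrite muleC muleA -!EFinM; move: (_ * _)%R => u u0.
case: (mean_ratio M x.1) => [r| |]; [|by rewrite invey mule0 lee01|by []].
rewrite lee_fin inver => ur; case: eqP => [r0|/eqP r0].
  by rewrite (_ : u = 0%R) ?mul0e ?lee01//; apply/eqP; rewrite eq_le u0 -r0 ur.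
have r_gt0 : (0 < r)%R by rewrite lt_neqAle eq_sym r0 (le_trans u0).
by rewrite -EFinM lee_fin ler_pdivrMr ?mul1r.
Qed.

Lemma mean_ratio_ge0 t : pm_X M t -> 0 <= mean_ratio M t.
Proof.
move=> Xt; apply: integral_ge0 => t' Xt'.
by rewrite lee_fin mulr_ge0 ?pm_q_ge0 ?mh_ratio_ge0.
Qed.

Lemma measurable_mean_ratio :
  measurable_fun (pm_space M) (fun x => mean_ratio M x.1).
Proof.
have mX := pm_mX M; have mXX := measurableX mX mX.
pose F := (fun p => pm_q M p.1 p.2 * mh_ratio M p.1 p.2)%R \_ (pm_X M `*` pm_X M).
have mswap (f : Rd R d * Rd R d -> R) : measurable_fun (pm_X M `*` pm_X M) f ->
    measurable_fun (pm_X M `*` pm_X M) (fun p => f (p.2, p.1)).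
  move=> mf; apply: (measurable_comp mXX _ mf (g := fun p => (p.2, p.1))).
    by move=> _ [[t t'] [Xt Xt'] <-].
  by apply: measurable_funTS; exact: measurable_swap.
have mpi1 : measurable_fun (pm_X M `*` pm_X M) (fun p : Rd R d * Rd R d => pm_pi M p.1).
  apply: (measurable_comp mX _ (pm_mpi M) (g := fst)).
    by move=> _ [[t t'] [Xt Xt'] <-].
  by apply: measurable_funTS; exact: measurable_fst.
have mF : measurable_fun setT F.
  apply/(measurable_restrictT _ mXX); apply: measurable_funM; first exact: pm_mq.
  apply: measurable_funM.
    by apply: measurable_funM; [exact: (mswap _ mpi1)|exact: (mswap _ (pm_mq M))].
  by apply: measurable_fun_invr; apply: measurable_funM => //; exact: pm_mq.
have F0 p : (0 <= F p)%R.
  rewrite /F patchE; case: ifPn => // /[!inE] -[Xt Xt'].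
  by rewrite mulr_ge0 ?pm_q_ge0 ?mh_ratio_ge0.
have mint : measurable_fun setT (fun t => \int[lebesgue_Rd R d]_t' (F (t, t'))%:E).
  apply: (measurable_fun_fubini_tonelli_F (m2 := lebesgue_Rd R d)
    (fun p => (F p)%:E)); first exact/measurable_EFinP.
  by move=> p; rewrite lee_fin.
apply: (eq_measurable_fun (fun x : T => \int[lebesgue_Rd R d]_t' (F (x.1, t'))%:E)).
  move=> x /[!inE] -[Xx _]; rewrite /mean_ratio [RHS]integral_mkcond.
  apply: eq_integral => t' _; rewrite /F !patchE.
  have [Xt'|Xt'] := boolP (t' \in pm_X M).
    by rewrite mem_set//=; split => //=; exact: set_mem.
  by rewrite memNset// => -[_ /= /mem_set]; exact/negP.
by apply: measurable_funTS; exact: (measurableT_comp mint measurable_fst).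
Qed.

End pseudo_marginal.

(** [h] is centred because a constant shift preserves the variance but not the right side, which can
    be positive for constant [h]. Convergence is part of the claim, so that [limn] is a genuine
    limit. *)
Theorem theorem2 (R : realType) (d : nat) (M : pm_model R d) (eps : R)
    (eps_gt0 : (0 < eps)%R)
    (gapE : left_spectral_gap (pm_stationary M) (pm_kernel M) = eps%:E)
    (dO : measure_display) (Omega : measurableType dO)
    (P : probability Omega R) (X : nat -> {RV P >-> pm_state R d})
    (chainX : markov_chain (pm_stationary M) (pm_kernel M) X)
    (h : pm_state R d -> R) (hL2 : L2_0 (pm_stationary M) h) :
  cvgn (scaled_mean_variance X h) /\
  ((- eps^-1)%:E + eps%:E / (4 - 2 * eps)%:E) *
      'N[pm_stationary M]_2%:E[EFin \o h] ^+ 2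
    + 2^-1%:E *
      \int[pm_leb R d]_(x in pm_space M)
        ((pm_pi M x.1 * pm_qw M x.1 x.2 * h x ^+ 2 * (x.2 : R) ^+ 2)%:E
           / mean_ratio M x.1)
  <= asymptotic_variance X h.
Proof.
have mK := @measurable_pm_move R d M.
have revK := @reversible_pm_move R d M.
have KT := @pm_move_setT R d M.
have a_le1 := @pm_acc_le1 R d M.
have QE := @pm_kernelE R d M.
have revQ := reversible_rejection_kernel mK revK KT a_le1 QE.
have L2h := hL2.1.
have [cvgy|[l [cvgl lb]]] :=
  reversible_chain_variance revQ eps_gt0 gapE chainX hL2.
  split; first by apply/cvg_ex; exists +oo.
  by rewrite /asymptotic_variance (cvg_lim _ cvgy)// leey.
split; first by apply/cvg_ex; exists l%:E.
rewrite /asymptotic_variance (cvg_lim _ cvgl)// Lnorm2_sqr//.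
apply: (variational_gap_bound revQ eps_gt0 gapE hL2 lb).
pose y := (fun x : pm_state R d => (x.2 : R)%:E / mean_ratio M x.1) \_ (pm_space M).
have gy : ge0_mfun y.
  split; last first.
    move=> x; rewrite /y patchE; case: ifPn => // /[!inE] -[Xx Wx].
    rewrite mule_ge0 ?lee_fin ?(pm_W_ge0 Wx)// inve_ge0.
    exact: mean_ratio_ge0.
  apply/(measurable_restrictT _ (measurable_pm_space M)).
  apply: emeasurable_funM.
    by apply/measurable_EFinP; apply: measurable_funTS; exact: measurable_snd.
  apply: measurable_fun_inve.
  exact: measurable_mean_ratio.
have ay x : (pm_acc M x)%:E * y x <= 1.
  rewrite /y patchE; case: ifPn => [/[!inE] xS|_]; last by rewrite mule0 lee01.
  exact: pm_acc_div_mean_ratio.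
have := weighted_sqr_le mK revK KT a_le1 QE L2h lb gy ay.
apply: le_trans.
rewrite ge0_integral_pm_stationary; last first.
  split=> [|x]; last by rewrite mule_ge0 ?lee_fin ?sqr_ge0//; exact: gy.2.
  apply: emeasurable_funM; last exact: gy.1.
  apply/measurable_EFinP; apply: measurable_funX; exact: (Lfun2_measurable L2h).
(* One factor [w] comes from the stationary density, the other from the weight [w / r]. *)
rewrite integral_mkcond le_eqVlt; apply/orP; left; apply/eqP.
apply: eq_integral => x _.
rewrite /y /pm_density !patchE; case: ifPn => xS; last by rewrite mul0e.
rewrite muleA muleA -!EFinM; congr (_%:E * _); rewrite /pm_nu; ring.
Qed.
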